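(* Let $0<\beta<1$ and $\alpha,p,\lambda>0$. The fractional negative binomial process $\{Q_\beta(t,\lambda)\}_{t\ge0}$ has the long-range dependence property.
   Context: Gamma process: $\{\Gamma(t)\}_{t\ge0}$ is the gamma subordinator with $\Gamma(t)\sim G(\alpha,pt)$, i.e. with density $\frac{\alpha^{pt}}{\Gamma(pt)}y^{pt-1}e^{-\alpha y}$, $y>0$. Fractional Poisson process (FPP): $N_\beta(t,\lambda)=N(E_\beta(t),\lambda)$ where $N(\cdot,\lambda)$ is a Poisson process of rate $\lambda$, independent of $E_\beta(t)=\inf\{s>0:D_\beta(s)>t\}$, with $D_\beta$ the $\beta$-stable subordinator, $\mathbb{E}[e^{-sD_\beta(t)}]=e^{-ts^\beta}$. Fractional negative binomial process (FNBP): $Q_\beta(t,\lambda)=N_\beta(\Gamma(t),\lambda)$, with $\{N_\beta(t,\lambda)\}$ independent of $\{\Gamma(t)\}$. Long-range dependence (LRD): let $s>0$ be fixed and $t>s$. Suppose a process $\{X(t)\}_{t\ge0}$ has a correlation function $\mathrm{Corr}(X(s),X(t))$ which behaves like $t^{-d}$ for large $t$, i.e. $\mathrm{Corr}(X(s),X(t))\sim c(s)\,t^{-d}$ as $t\to\infty$ with $c(s)>0$, for some $d>0$ (not depending on $s$). Then $\{X(t)\}$ has the LRD property if $d\in(0,1)$. *)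

(* Defs.v *)
From HB Require Import structures.
From mathcomp Require Import all_boot all_order all_algebra.
From mathcomp Require Import all_classical all_reals all_analysis.

Set Implicit Arguments.
Unset Strict Implicit.
Unset Printing Implicit Defensive.

Import Order.TTheory GRing.Theory Num.Theory.
Import numFieldNormedType.Exports.

Local Open Scope classical_set_scope.
Local Open Scope ring_scope.

(* Processes have index set [0, +oo[, encoded as functions on R that are only
   constrained at nonnegative times. *)

Section processes.
Context {d : measure_display} {T : measurableType d} {R : realType}.
Variable P : probability T R.
Implicit Types (X Y : R -> T -> R).

(* The sigma-algebra sigma(X_t, t >= 0). *)
Definition sigma_process X : set (set T) :=
  <<s [set A | exists t B, [/\ 0 <= t, measurable B & A = X t @^-1` B]] >>.

Definition independent_processes X Y : Prop :=
  forall A B, sigma_process X A -> sigma_process Y B ->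
    P (A `&` B) = (P A * P B)%E.

Definition increment X (s t : R) (w : T) : R := X t w - X s w.

Definition independent_increments X : Prop :=
  forall (n : nat) (t : nat -> R) (B : nat -> set R),
    0 <= t 0%N -> {homo t : i j / (i <= j)%N >-> i <= j} ->
    (forall i, measurable (B i)) ->
    P (\bigcap_(i < n) (increment X (t i) (t i.+1) @^-1` B i)) =
    (\prod_(i < n) P (increment X (t i) (t i.+1) @^-1` B i))%E.

Definition stationary_increments X : Prop :=
  forall (t h : R) (B : set R), 0 <= t -> 0 <= h -> measurable B ->
    P (increment X t (t + h) @^-1` B) = P (X h @^-1` B).

Definition cadlag (x : R -> R) : Prop :=
  (forall t, 0 <= t -> x u @[u --> t^'+] --> x t) /\
  (forall t, 0 < t -> cvg (x u @[u --> t^'-])).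

(* Path properties are required for every outcome: otherwise the composed
   processes below need not be measurable when P is not complete. *)
Record levy_process (X : R -> {RV P >-> R}) : Prop := {
  levy_start : forall w, X 0 w = 0 ;
  levy_indep : independent_increments (fun t => X t) ;
  levy_stat : stationary_increments (fun t => X t) ;
  levy_cadlag : forall w, cadlag (fun t => X t w) }.

Record subordinator (X : R -> {RV P >-> R}) : Prop := {
  subordinator_levy : levy_process X ;
  subordinator_nd : forall w s t, 0 <= s -> s <= t -> X s w <= X t w }.

(* At t = 0 the law is fixed by levy_start; the library's poisson_pmf is not a
   probability mass function at rate 0. *)
Record poisson_process (lambda : R) (N : R -> {RV P >-> R}) : Prop := {
  poisson_levy : levy_process N ;
  poisson_law : forall (t : R) (k : nat), 0 < t ->
    P (N t @^-1` [set k%:R]) = (poisson_pmf (lambda * t) k)%:E }.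

Record stable_subordinator (beta : R) (D : R -> {RV P >-> R}) : Prop := {
  stable_sub : subordinator D ;
  stable_laplace : forall s t : R, 0 < s -> 0 <= t ->
    'E_P[fun w => expR (- (s * D t w))]%E = (expR (- (t * s `^ beta)))%:E }.

Definition gamma_fun (a : R) : R :=
  \int[lebesgue_measure]_(x in `]0, +oo[) (x `^ (a - 1) * expR (- x)).

(* Density on ]0, +oo[ of the law G(a, b): rate a, shape b. *)
Definition gamma_pdf (a b y : R) : R :=
  a `^ b / gamma_fun b * y `^ (b - 1) * expR (- (a * y)).

Record gamma_process (alpha p : R) (G : R -> {RV P >-> R}) : Prop := {
  gamma_sub : subordinator G ;
  gamma_law : forall (t : R) (B : set R), 0 < t -> measurable B ->
    P (G t @^-1` B) =
    (\int[lebesgue_measure]_(y in B `&` `]0%R, +oo[)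
       (gamma_pdf alpha (p * t) y)%:E)%E }.

(* The set is nonempty almost surely when D is a stable subordinator; [inf]
   returns 0 on the remaining outcomes. *)
Definition inverse_process (D : R -> {RV P >-> R}) (t : R) (w : T) : R :=
  inf [set s : R | 0 < s /\ t < D s w].

Definition fpp (D N : R -> {RV P >-> R}) (t : R) (w : T) : R :=
  N (inverse_process D t w) w.

Definition fnbp (D N G : R -> {RV P >-> R}) (t : R) (w : T) : R :=
  fpp D N (G t w) w.

Definition correlation (X Y : T -> R) : R :=
  fine (covariance P X Y) /
  (Num.sqrt (fine ('V_P[X])%E) * Num.sqrt (fine ('V_P[Y])%E)).

(* Square integrability makes the correlations genuine; a vanishing variance
   at some s > 0 is excluded by 0 < c. *)
Definition long_range_dependent X : Prop :=
  (forall t, 0 <= t -> X t \in Lfun P 2%:E) /\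
  exists2 e : R, 0 < e < 1 &
    forall s : R, 0 < s -> exists2 c : R, 0 < c &
      correlation (X s) (X t) / (c * t `^ (- e)) @[t --> +oo] --> (1 : R).

End processes.

(* Main.v *)
Require Import Defs.
From HB Require Import structures.
From mathcomp Require Import all_boot all_order all_algebra.
From mathcomp Require Import all_classical all_reals all_analysis.
From mathcomp Require Import measurable_realfun ring lra zify.
Import Order.TTheory GRing.Theory Num.Theory.
Import numFieldNormedType.Exports.
Local Open Scope classical_set_scope.
Local Open Scope ring_scope.
Set Implicit Arguments.
Unset Strict Implicit.
Unset Printing Implicit Defensive.

(** Write E for the inverse of the stable subordinator D, X = N o E for the
fractional Poisson process and Q = X o G for the fractional negative binomial
process. The correlation of Q(s) and Q(t) decays like t^(-beta), and beta lies
in ]0, 1[, because the covariance of Q(s) and Q(t) tends to a positive constant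
while the variance of Q(t) grows like t^(2 beta). Moments of order one and two
suffice, and no special function has to be evaluated.

Conditioning on the time change. Let X be right-continuous and independent of a
process Y >= 0. On the product of the sigma-algebras generated by X and by Y the
diagonal has a product law, so E F(X(Y_s), X(Y_t)) is obtained by freezing Y and
then averaging over Y ([integral_subordinated]). This is used for N o E and
for X o G.

The processes N and G. Stationary independent increments make the mean and the
variance additive in time, hence linear, so E Z_s = m s and
E Z_s Z_t = v s + m^2 s t for s <= t ([levy_moments]).

The process E. Laplace transforms determine laws ([laplace_transform_unique]),
so D_(c^beta t) has the law of c D_t and E_(c t) that of c^beta E_t; thus
E E_t = C1 t^beta and E E_t^2 = C2 t^(2 beta). Up to an arbitrarily small shift
of a and b, the event {E_u > a, E_v > a + b} is {D_a <= u, D_(a+b) <= v}. It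
contains {D_a <= u, D_(a+b) - D_a <= v - u} and is contained in
{D_a <= u, D_(a+b) - D_a <= v}, so independence of the increments of D gives

  P(E_u > a) P(E_(v-u) > b) <= P(E_u > a, E_v > a + b) <= P(E_u > a) P(E_v > b)

([inverse_joint_tail_bounds]). Integrated over a, b >= 0 the middle term is
E[E_u E_v] - E[E_u^2] / 2, so

  C2/2 u^(2 beta) + C1^2 u^beta (v - u)^beta <= E[E_u E_v]
                                   <= C2/2 u^(2 beta) + C1^2 u^beta v^beta

([stable_inverse_second_order]). If E_1 were deterministic, the lower bound
would fail for u = 1 and large v, hence C1^2 < C2. Conditioning transfers all
this to X with new constants a, b, c such that a^2 < 2 c ([fpp_second_order]).

The process Q. Let mu(t) and nu(t) be the first two moments of G_t^beta.
Conditioning on G shows that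

  Var Q_t = b mu(t) + 2 c nu(t) - a^2 mu(t)^2

and that Cov(Q_s, Q_t) differs from kappa(s) = b mu(s) + c nu(s) > 0 by at least
- a^2 mu(s) (mu(t) - mu(t - s)) and at most
a^2 (E[G_s^beta G_t^beta] - mu(s) mu(t)). Since G_t has mean m t and a variance
linear in t, mu(t) ~ (m t)^beta and nu(t) ~ (m t)^(2 beta), so the variance is
equivalent to (2 c - a^2) (m t)^(2 beta) ([normalized_power_means]). Since
x^beta has a vanishing slope at infinity, replacing G_t by the increment
G_t - G_s, which is independent of G_s, changes the moments at hand by o(1)
([cross_power_bounds]), and the covariance tends to kappa(s)
([long_range_dependent_subordinated]). *)

(** * Evaluating a process at an independent random time *)

Section independence.
Context {d d1 d2 : measure_display} {T : measurableType d}
  {T1 : measurableType d1} {T2 : measurableType d2} {R : realType}.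
Variable P : probability T R.

Definition independent_pair (X : T -> T1) (Y : T -> T2) : Prop :=
  forall A B, measurable A -> measurable B ->
    P (X @^-1` A `&` Y @^-1` B) = (P (X @^-1` A) * P (Y @^-1` B))%E.

Local Open Scope ereal_scope.

(** Independence says that the law of the pair is the product of the laws, by
uniqueness of the product measure on rectangles; the rest is Tonelli. *)
Lemma integral_independent_pair (X : T -> T1) (Y : T -> T2)
    (F : T1 * T2 -> \bar R) :
  measurable_fun setT X -> measurable_fun setT Y -> independent_pair X Y ->
  measurable_fun setT F -> (forall z, 0 <= F z) ->
  measurable_fun setT (fun y => \int[P]_w F (X w, y)) /\
  \int[P]_w F (X w, Y w) = \int[P]_w' \int[P]_w F (X w, Y w').
Proof.
move=> mX mY XY mF F0.
pose X' : {mfun T >-> T1} := mfun_Sub (mem_set mX : X \in mfun).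
pose Y' : {mfun T >-> T2} := mfun_Sub (mem_set mY : Y \in mfun).
have mXY : measurable_fun setT (fun w => (X w, Y w)).
  exact: measurable_fun_pair.
pose XY' : {mfun T >-> (T1 * T2)%type} :=
  mfun_Sub (mem_set mXY : (fun w => (X w, Y w)) \in mfun).
have int1 y : \int[distribution P X']_x F (x, y) = \int[P]_w F (X w, y).
  rewrite ge0_integral_distribution//.
  exact: measurableT_comp mF (pair2_measurable _).
split.
  rewrite [X in measurable_fun _ X](_ : _ =
      fubini_G (distribution P X') F); last first.
    by apply/funext => y; rewrite /fubini_G int1.
  exact: measurable_fun_fubini_tonelli_G.
transitivity (\int[distribution P XY']_z F z).
  by rewrite ge0_integral_distribution.
transitivity (\int[distribution P X' \x distribution P Y']_z F z).
  apply: eq_measure_integral => A mA _; apply/esym.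
  by apply: product_measure_unique mA => B C mB mC; exact: XY.
rewrite fubini_tonelli2// ge0_integral_distribution//.
- by apply: eq_integral => w _; rewrite /= /fubini_G int1.
- exact: measurable_fun_fubini_tonelli_G.
- by move=> y; exact: integral_ge0.
Qed.

End independence.

Section subordination.
Context {d : measure_display} {T : measurableType d} {R : realType}.

(** The process is evaluated at the point of the grid of mesh 1/(n+1) that comes
strictly after Y. That time takes countably many values and tends to Y from the
right, where X is right-continuous. The path and the time live on two different
spaces, as needed to integrate over them separately. *)
Lemma measurable_eval_right_continuous {d1 d2 : measure_display}
    {T1 : measurableType d1} {T2 : measurableType d2}
    (X : R -> T1 -> R) (Y : T2 -> R) :
  (forall t, 0 <= t -> measurable_fun setT (X t)) ->
  (forall w t, 0 <= t -> X u w @[u --> t^'+] --> X t w) ->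
  measurable_fun setT Y -> (forall w, 0 <= Y w) ->
  measurable_fun setT (fun z : T1 * T2 => X (Y z.2) z.1).
Proof.
move=> mX rcX mY Y0.
pose k n z := Num.truncn (n.+1%:R * Y z).
have kP n z : (k n z)%:R <= n.+1%:R * Y z < (k n z).+1%:R.
  by apply: truncn_itv; rewrite mulr_ge0.
apply: (@measurable_fun_cvg _ _ _ _
    (fun n (z : T1 * T2) => X ((k n z.2).+1%:R / n.+1%:R) z.1)) => [n|[w1 w2] _ /=].
  pose A i := [set z : T1 * T2 | i%:R <= n.+1%:R * Y z.2 < i.+1%:R].
  have mA i : measurable (A i).
    have -> : A i = (fun z : T1 * T2 => n.+1%:R * Y z.2) @^-1` `[i%:R, i.+1%:R[.
      by apply/seteqP; split => z /=; rewrite in_itv.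
    rewrite -[X in measurable X]setTI; apply: (measurable_funM _ _) => //.
    exact: measurableT_comp mY measurable_snd.
  have -> : [set: T1 * T2] = \bigcup_i A i.
    by apply/seteqP; split => // z _; exists (k n z.2) => //; exact: kP.
  apply/measurable_fun_bigcup => // i.
  apply: (@eq_measurable_fun _ _ _ _ _ (fun z => X (i.+1%:R / n.+1%:R) z.1)).
    by move=> z; rewrite inE => /truncn_def ki; rewrite /k ki.
  apply: measurable_funTS; apply: measurableT_comp measurable_fst.
  by apply: mX; rewrite divr_ge0.
apply: (iffLR (cvg_at_rightP (X^~ w1) (Y w2) _) (rcX w1 _ (Y0 w2))); split.
  by move=> n; rewrite ltr_pdivlMr// mulrC; have /andP[] := kP n w2.
apply: (@squeeze_cvgr _ _ _ _ (cst (Y w2)) (fun n => Y w2 + n.+1%:R^-1)).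
- apply: nearW => n /=; have /andP[k1 k2] := kP n w2.
  rewrite ler_pdivlMr// mulrC (ltW k2)/= ler_pdivrMr// mulrDl mulVf//.
  by rewrite -natr1 lerD2r mulrC.
- exact: cvg_cst.
- rewrite -[X in _ --> X]addr0; apply: cvgD; first exact: cvg_cst.
  exact: cvg_harmonic.
Qed.

Definition process_cylinders (X : R -> T -> R) : set (set T) :=
  [set A | exists t B, [/\ 0 <= t, measurable B & A = X t @^-1` B]].

Lemma measurable_to_sigma_process (X : R -> T -> R) :
  (forall t, 0 <= t -> measurable_fun setT (X t)) ->
  measurable_fun setT (idfun : T -> g_sigma_algebraType (process_cylinders X)).
Proof.
move=> mX _ A /= mA; rewrite setTI.
suff : <<s process_cylinders X>> `<=` measurable by exact.
apply: smallest_sub; first exact: sigma_algebra_measurable.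
by move=> _ [t [B [t0 mB ->]]]; rewrite -[X in measurable X]setTI; exact: mX.
Qed.

Lemma measurable_sigma_process (X : R -> T -> R) (t : R) : 0 <= t ->
  measurable_fun setT (X t : g_sigma_algebraType (process_cylinders X) -> R).
Proof.
by move=> t0 _ B mB; rewrite setTI; apply: sub_sigma_algebra; exists t, B.
Qed.

Section subordinated_process.
Variables (P : probability T R) (X Y : R -> T -> R).
Hypothesis mX : forall t, 0 <= t -> measurable_fun setT (X t).
Hypothesis rcX : forall w t, 0 <= t -> X u w @[u --> t^'+] --> X t w.
Hypothesis mY : forall t, 0 <= t -> measurable_fun setT (Y t).
Hypothesis Y0 : forall w t, 0 <= t -> 0 <= Y t w.

(** T carries here only the events that X, resp. Y, can see: for these two
coarser sigma-algebras the independence of the processes says exactly that the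
two copies of the identity of T are independent. *)
Let TX : measurableType _ := g_sigma_algebraType (process_cylinders X).
Let TY : measurableType _ := g_sigma_algebraType (process_cylinders Y).

Let measurable_eval t : 0 <= t ->
  measurable_fun setT (fun z : TX * TY => X (Y t z.2) z.1).
Proof.
move=> t0.
apply: (@measurable_eval_right_continuous _ _ TX TY X (Y t)) => //.
- by move=> u u0; exact: measurable_sigma_process.
- exact: measurable_sigma_process.
- by move=> w; exact: Y0.
Qed.

Lemma measurable_subordinated t : 0 <= t ->
  measurable_fun setT (fun w => X (Y t w) w).
Proof.
move=> t0.
have mdiag : measurable_fun setT (fun w : T => (w, w) : TX * TY).
  exact: (@measurable_fun_pair _ _ _ T TX TY idfun idfun
    (measurable_to_sigma_process mX) (measurable_to_sigma_process mY)).
exact: measurableT_comp (measurable_eval t0) mdiag.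
Qed.

Hypothesis XY : independent_processes P X Y.

Local Open Scope ereal_scope.

(** A conditional expectation given Y, written without conditioning: Y is frozen
at w' in the inner integral. Two times are needed for covariances. *)
Lemma integral_subordinated (F : R * R -> \bar R) (s t : R) :
  measurable_fun setT F -> (forall z, 0 <= F z) -> (0 <= s)%R -> (0 <= t)%R ->
  measurable_fun setT (fun w' => \int[P]_w F (X (Y s w') w, X (Y t w') w)) /\
  \int[P]_w F (X (Y s w) w, X (Y t w) w) =
  \int[P]_w' \int[P]_w F (X (Y s w') w, X (Y t w') w).
Proof.
move=> mF F0 s0 t0.
have mid := measurable_to_sigma_process.
have mG : measurable_fun setT
    (fun z : TX * TY => F (X (Y s z.2) z.1, X (Y t z.2) z.1)).
  exact: measurableT_comp mF
    (measurable_fun_pair (measurable_eval s0) (measurable_eval t0)).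
have ind : independent_pair P (idfun : T -> TX) (idfun : T -> TY).
  by move=> A B mA mB; exact: XY.
have [mI ->] := integral_independent_pair (mid _ mX) (mid _ mY) ind mG
  (fun=> F0 _).
by split => //; exact: measurableT_comp mI (mid _ mY).
Qed.

End subordinated_process.
End subordination.

(** * Expectations of nonnegative random variables *)

Section expectation_tools.
Context {d : measure_display} {T : measurableType d} {R : realType}.
Variable P : probability T R.
Local Open Scope ereal_scope.

Lemma eq_law_integral (X Y : T -> R) (F : R -> \bar R) :
  measurable_fun setT X -> measurable_fun setT Y ->
  (forall B, measurable B -> P (X @^-1` B) = P (Y @^-1` B)) ->
  measurable_fun setT F -> (forall x, 0 <= F x) ->
  \int[P]_w F (X w) = \int[P]_w F (Y w).
Proof.
move=> mX mY XY mF F0.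
pose X' : {mfun T >-> R} := mfun_Sub (mem_set mX : X \in mfun).
pose Y' : {mfun T >-> R} := mfun_Sub (mem_set mY : Y \in mfun).
transitivity (\int[distribution P X']_x F x).
  by rewrite ge0_integral_distribution.
transitivity (\int[distribution P Y']_x F x).
  by apply: eq_measure_integral => A mA _; exact: XY.
by rewrite ge0_integral_distribution.
Qed.

Lemma integral_mul_independent_pair (X Y : T -> R) (f g : R -> R) :
  measurable_fun setT X -> measurable_fun setT Y -> independent_pair P X Y ->
  measurable_fun setT f -> measurable_fun setT g ->
  (forall x, (0 <= f x)%R) -> (forall x, (0 <= g x)%R) ->
  \int[P]_w (f (X w) * g (Y w))%:E =
  \int[P]_w (f (X w))%:E * \int[P]_w (g (Y w))%:E.
Proof.
move=> mX mY XY mf mg f0 g0.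
have mF : measurable_fun setT (fun z : R * R => (f z.1 * g z.2)%:E).
  apply/measurable_EFinP/measurable_funM.
    exact: measurableT_comp mf measurable_fst.
  exact: measurableT_comp mg measurable_snd.
have F0 (z : R * R) : 0 <= (f z.1 * g z.2)%:E by rewrite lee_fin mulr_ge0.
have [_ /= ->] := integral_independent_pair mX mY XY mF F0.
have inner w' : \int[P]_w (f (X w) * g (Y w'))%:E =
    (g (Y w'))%:E * \int[P]_w (f (X w))%:E.
  under eq_integral => w _ do rewrite mulrC EFinM.
  rewrite ge0_integralZl_EFin//.
  - by move=> w _; rewrite lee_fin.
  - exact/measurable_EFinP/measurableT_comp.
under eq_integral do rewrite inner.
rewrite ge0_integralZr//.
- by rewrite muleC.
- exact/measurable_EFinP/measurableT_comp.
- by move=> w _; rewrite lee_fin.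
- by apply: integral_ge0 => w _; rewrite lee_fin.
Qed.

Lemma integral_cst_probability (c : \bar R) : \int[P]_w c = c.
Proof.
by rewrite -[RHS]mule1 -(@probability_setT _ _ _ P); exact: integral_cst.
Qed.

(** Cauchy-Schwarz for a probability, by integrating 2 a f <= f^2 + a^2. *)
Lemma le_integral_sqr (f : T -> R) (a b : R) :
  measurable_fun setT f -> (forall w, (0 <= f w)%R) ->
  \int[P]_w (f w)%:E = a%:E -> \int[P]_w (f w ^+ 2)%:E = b%:E ->
  (a ^+ 2 <= b)%R.
Proof.
move=> mf f0 fa fb.
have a0 : (0 <= a)%R.
  by rewrite -lee_fin -fa integral_ge0// => w _; rewrite lee_fin.
have : \int[P]_w (2 * a * f w)%:E <= \int[P]_w (f w ^+ 2 + a ^+ 2)%:E.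
  apply: ge0_le_integral => //.
  - by move=> w _; rewrite lee_fin !mulr_ge0.
  - exact/measurable_EFinP/measurable_funM.
  - apply/measurable_EFinP/measurable_funD => //.
    exact: measurable_funX.
  - move=> w _; rewrite lee_fin; have := sqr_ge0 (f w - a); nra.
under eq_integral do rewrite EFinM.
under [leRHS]eq_integral do rewrite EFinD.
rewrite ge0_integralZl_EFin//; last 3 first.
- by move=> w _; rewrite lee_fin.
- exact/measurable_EFinP.
- by rewrite mulr_ge0.
rewrite ge0_integralD//; last 3 first.
- by move=> w _; rewrite lee_fin sqr_ge0.
- exact/measurable_EFinP/measurable_funX.
- by move=> w _; rewrite lee_fin sqr_ge0.
rewrite integral_cst_probability fa fb -EFinM -EFinD lee_fin => h.
nra.
Qed.

Lemma ge0_integralD_EFin (f g : T -> R) :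
  measurable_fun setT f -> measurable_fun setT g ->
  (forall w, (0 <= f w)%R) -> (forall w, (0 <= g w)%R) ->
  \int[P]_w (f w + g w)%:E = \int[P]_w (f w)%:E + \int[P]_w (g w)%:E.
Proof.
move=> mf mg f0 g0; under eq_integral do rewrite EFinD.
by apply: ge0_integralD => //; try exact/measurable_EFinP;
  move=> w _; rewrite lee_fin.
Qed.

Lemma ge0_integralM_EFin (c : R) (f : T -> R) :
  measurable_fun setT f -> (0 <= c)%R -> (forall w, (0 <= f w)%R) ->
  \int[P]_w (c * f w)%:E = c%:E * \int[P]_w (f w)%:E.
Proof.
move=> mf c0 f0; under eq_integral do rewrite EFinM.
by apply: ge0_integralZl_EFin => //; try exact/measurable_EFinP;
  move=> w _; rewrite lee_fin.
Qed.

Lemma ae_le_integral_EFin (f g : T -> R) :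
  measurable_fun setT f -> measurable_fun setT g ->
  (forall w, (0 <= f w)%R) -> (forall w, (0 <= g w)%R) ->
  {ae P, forall w, (f w <= g w)%R} ->
  \int[P]_w (f w)%:E <= \int[P]_w (g w)%:E.
Proof.
move=> mf mg f0 g0 fg; apply: ae_ge0_le_integral => //.
- by move=> w _; rewrite lee_fin.
- exact/measurable_EFinP.
- by move=> w _; rewrite lee_fin.
- exact/measurable_EFinP.
- by apply: filterS fg => w fg _; rewrite lee_fin.
Qed.

Lemma ge0_le_integral_EFin (f g : T -> R) :
  measurable_fun setT f -> measurable_fun setT g ->
  (forall w, (0 <= f w)%R) -> (forall w, (f w <= g w)%R) ->
  \int[P]_w (f w)%:E <= \int[P]_w (g w)%:E.
Proof.
move=> mf mg f0 fg; apply: ge0_le_integral => //.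
- by move=> w _; rewrite lee_fin.
- exact/measurable_EFinP.
- exact/measurable_EFinP.
- by move=> w _; rewrite lee_fin.
Qed.

Lemma measurable_preimage (X : T -> R) (B : set R) :
  measurable_fun setT X -> measurable B -> measurable (X @^-1` B).
Proof. by move=> mX mB; rewrite -[X in measurable X]setTI; exact: mX. Qed.

Lemma measurable_set_gt (X : T -> R) (a : R) :
  measurable_fun setT X -> measurable [set w | (a < X w)%R].
Proof.
move=> mX; rewrite [X in measurable X](_ : _ = X @^-1` `]a, +oo[%classic).
  exact: measurable_preimage.
by apply/seteqP; split => w /=; rewrite in_itv/= andbT.
Qed.

Lemma measurable_set_le (X : T -> R) (a : R) :
  measurable_fun setT X -> measurable [set w | (X w <= a)%R].
Proof.
move=> mX; rewrite [X in measurable X](_ : _ = X @^-1` `]-oo, a]%classic).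
  exact: measurable_preimage.
by apply/seteqP; split => w /=; rewrite in_itv.
Qed.

Lemma ae_ge0P (X : T -> R) : measurable_fun setT X ->
  {ae P, forall w, (0 <= X w)%R} <-> P (X @^-1` `]-oo, 0%R[) = 0.
Proof.
move=> mX; rewrite -negligibleP; last exact: measurable_preimage.
rewrite (_ : X @^-1` _ = ~` [set w | (0 <= X w)%R])//.
by apply/seteqP; split => w /=; rewrite in_itv/= ltNge => /negP.
Qed.

Lemma ae_eq_integral_EFin (f g : T -> R) :
  measurable_fun setT f -> measurable_fun setT g ->
  (forall w, (0 <= f w)%R) -> (forall w, (0 <= g w)%R) ->
  {ae P, forall w, f w = g w} -> \int[P]_w (f w)%:E = \int[P]_w (g w)%:E.
Proof.
move=> mf mg f0 g0 fg; apply: ge0_ae_eq_integral => //.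
- exact/measurable_EFinP.
- exact/measurable_EFinP.
- by move=> w _; rewrite lee_fin.
- by move=> w _; rewrite lee_fin.
- by apply: filterS fg => w /= -> _.
Qed.

Lemma measure_ae_le (A B : set T) : measurable A -> measurable B ->
  {ae P, forall w, A w -> B w} -> P A <= P B.
Proof.
move=> mA mB AB; rewrite -[A]setIT -[B]setIT -!integral_indic//.
apply: ae_le_integral_EFin => //.
apply: filterS AB => w AB; rewrite !indicE ler_nat.
have [/set_mem Aw|//] := boolP (w \in A).
by rewrite (mem_set (AB Aw)).
Qed.

Lemma measure_ae_eq (A B : set T) : measurable A -> measurable B ->
  {ae P, forall w, A w <-> B w} -> P A = P B.
Proof.
move=> mA mB AB; apply/eqP; rewrite eq_le !measure_ae_le//.
- by apply: filterS AB => w [].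
- by apply: filterS AB => w [].
Qed.

(** The layer-cake formula. *)
Lemma ge0_integral_tail (X : T -> R) :
  measurable_fun setT X -> (forall w, (0 <= X w)%R) ->
  \int[P]_w (X w)%:E =
  \int[lebesgue_measure]_(r in `[0%R, +oo[) P [set w | (r < X w)%R].
Proof.
move=> mX X0.
pose X' : {mfun T >-> R} := mfun_Sub (mem_set mX : X \in mfun).
transitivity ('E_P[X']); first by rewrite expectation_def.
rewrite ge0_expectation_ccdf//; apply: eq_integral => r _.
rewrite /ccdf /distribution /pushforward; congr (P _).
by apply/seteqP; split => w /=; rewrite in_itv/= andbT.
Qed.

(** Nonnegativity is part of the notion, so that the integral always makes sense
and equalities between means can be combined without integrability conditions;
the real value m then records finiteness. *)
Definition has_mean (f : T -> R) (m : R) : Prop :=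
  [/\ measurable_fun setT f, forall w, (0 <= f w)%R &
      \int[P]_w (f w)%:E = m%:E].

Lemma has_meanD f g m n : has_mean f m -> has_mean g n ->
  has_mean (fun w => f w + g w)%R (m + n)%R.
Proof.
move=> [mf f0 fm] [mg g0 gn]; split.
- exact: measurable_funD.
- by move=> w; rewrite addr_ge0.
- by rewrite ge0_integralD_EFin// fm gn.
Qed.

Lemma has_meanZ c f m : (0 <= c)%R -> has_mean f m ->
  has_mean (fun w => c * f w)%R (c * m)%R.
Proof.
move=> c0 [mf f0 fm]; split.
- exact: measurable_funM.
- by move=> w; rewrite mulr_ge0.
- by rewrite ge0_integralM_EFin// fm.
Qed.

Lemma has_mean_cst c : (0 <= c)%R -> has_mean (cst c) c.
Proof. by move=> c0; split => //; exact: (integral_cst_probability c%:E). Qed.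

Lemma has_mean_le f g m n : has_mean f m -> has_mean g n ->
  (forall w, (f w <= g w)%R) -> (m <= n)%R.
Proof.
move=> [mf f0 fm] [mg g0 gn] fg.
by rewrite -lee_fin -fm -gn; exact: ge0_le_integral_EFin.
Qed.

Lemma has_mean_dominated (f g : T -> R) (n : R) : measurable_fun setT f ->
  (forall w, (0 <= f w)%R) -> has_mean g n -> (forall w, (f w <= g w)%R) ->
  has_mean f (fine (\int[P]_w (f w)%:E)).
Proof.
move=> mf f0 [mg g0 gn] fg; split => //; rewrite fineK// ge0_fin_numE.
  apply: (@le_lt_trans _ _ n%:E); last exact: ltry.
  by rewrite -gn; exact: ge0_le_integral_EFin.
by apply: integral_ge0 => w _; rewrite lee_fin.
Qed.

End expectation_tools.

(** * Moments of a nonnegative Levy process *)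

(** Cauchy's functional equation. Nonnegativity makes f nondecreasing, so n f(t)
lies between k f(1) and (k + 1) f(1), where k is the integer part of n t. *)
Lemma additive_ge0_linear {R : realType} (f : R -> R) :
  (forall s h, 0 <= s -> 0 <= h -> f (s + h) = f s + f h) ->
  (forall t, 0 <= t -> 0 <= f t) ->
  forall t, 0 <= t -> f t = f 1 * t.
Proof.
move=> fD f0 t t0.
have fM n u : 0 <= u -> f (n%:R * u) = n%:R * f u.
  move=> u0; elim: n => [|n IH].
    rewrite !mul0r; have := fD 0 0 (lexx _) (lexx _); rewrite addr0; lra.
  by rewrite -natr1 !mulrDl !mul1r fD ?IH// mulr_ge0.
have fmon u v : 0 <= u -> u <= v -> f u <= f v.
  move=> u0 uv; rewrite -[v](subrKC u) fD ?subr_ge0// lerDl.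
  by rewrite f0 ?subr_ge0.
have bound n : n%:R * `|f t - f 1 * t| <= f 1.
  have nt0 : 0 <= n%:R * t by rewrite mulr_ge0.
  have /andP[k1 k2] := truncn_itv nt0; set k := Num.truncn _ in k1 k2.
  have l1 : k%:R * f 1 <= n%:R * f t.
    by rewrite -!fM// mulr1 fmon.
  have l2 : n%:R * f t <= k%:R * f 1 + f 1.
    rewrite -[X in _ + X]mul1r -mulrDl natr1 -!fM// mulr1.
    by rewrite fmon// ltW.
  have f10 := f0 1 ler01.
  have e1 : k%:R * f 1 <= n%:R * t * f 1 by rewrite ler_wpM2r.
  have e2 : n%:R * t * f 1 <= k%:R * f 1 + f 1.
    by rewrite -[X in _ + X]mul1r -mulrDl natr1 ler_wpM2r// ltW.
  rewrite -[X in X * _]ger0_norm// -normrM mulrBr ler_norml.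
  apply/andP; split; nra.
apply/eqP; rewrite -subr_eq0 -normr_eq0; apply/negPn/negP => ne0.
have gt0 : 0 < `|f t - f 1 * t| by rewrite lt_neqAle eq_sym ne0 normr_ge0.
have [n nP] : exists n, f 1 / `|f t - f 1 * t| < n%:R.
  exists (Num.truncn (f 1 / `|f t - f 1 * t|)).+1.
  by have /andP[] := truncn_itv (divr_ge0 (f0 1 ler01) (ltW gt0)).
by move: nP; rewrite ltr_pdivrMr// ltNge bound.
Qed.

Section levy_moments.
Context {d : measure_display} {T : measurableType d} {R : realType}.
Variables (P : probability T R) (X : R -> {RV P >-> R}).
Hypothesis levyX : levy_process X.

Lemma levy_increment_law (s h : R) (B : set R) :
  0 <= s -> 0 <= h -> measurable B ->
  P ((fun w => X (s + h) w - X s w) @^-1` B) = P (X h @^-1` B).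
Proof. by move=> s0 h0 mB; exact: (levy_stat levyX). Qed.

(** X vanishes at 0, so X_s is itself an increment. *)
Lemma levy_increment_independent (s t : R) : 0 <= s -> s <= t ->
  independent_pair P (X s) (fun w => X t w - X s w).
Proof.
move=> s0 st A B mA mB.
pose u i : R := if i is j.+1 then if j is _.+1 then t else s else 0.
pose C (i : nat) := if i is _.+1 then B else A.
have uE : {homo u : i j / (i <= j)%N >-> i <= j}.
  case=> [|[|i]] [|[|j]] //= _.
  by apply: le_trans st.
have mC i : measurable (C i) by case: i.
have := @levy_indep _ _ _ _ _ levyX 2%N u C (lexx _) uE mC.
rewrite bigcap_mkord !big_ord_recr !big_ord0/= setTI mul1e.
have -> : increment X 0 s = X s.
  by apply/funext => w; rewrite /increment levy_start// subr0.
by [].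
Qed.

Hypothesis X_ge0 : forall t, 0 <= t -> {ae P, forall w, 0 <= X t w}.
Hypothesis X_sqr : forall t, 0 <= t -> (\int[P]_w (X t w ^+ 2)%:E < +oo)%E.

Let inc s h w := X (s + h) w - X s w.

Let minc s h : measurable_fun setT (inc s h).
Proof. exact: measurable_funB. Qed.

Let inc_ge0 s h : 0 <= s -> 0 <= h -> {ae P, forall w, 0 <= inc s h w}.
Proof.
move=> s0 h0.
have mB : measurable (`]-oo, 0[%classic : set R) by exact: measurable_itv.
apply/(ae_ge0P P (minc s h)); rewrite levy_increment_law//.
by apply/(ae_ge0P P); [exact: measurable_funPT|exact: X_ge0].
Qed.

Let A t := (\int[P]_w `|X t w|%:E)%E.
Let B t := (\int[P]_w (X t w ^+ 2)%:E)%E.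
Let C s t := (\int[P]_w `|X s w * X t w|%:E)%E.

Let incA s h : 0 <= s -> 0 <= h -> (\int[P]_w `|inc s h w|%:E)%E = A h.
Proof.
move=> s0 h0; apply: (eq_law_integral (F := fun x => `|x|%:E)) => //.
- by move=> D mD; exact: levy_increment_law.
- exact/measurable_EFinP.
Qed.

Let incB s h : 0 <= s -> 0 <= h -> (\int[P]_w (inc s h w ^+ 2)%:E)%E = B h.
Proof.
move=> s0 h0; apply: (eq_law_integral (F := fun x => (x ^+ 2)%:E)) => //.
- by move=> D mD; exact: levy_increment_law.
- exact/measurable_EFinP.
- by move=> x; rewrite lee_fin sqr_ge0.
Qed.

Let incAA s h : 0 <= s -> 0 <= h ->
  (\int[P]_w (`|X s w| * `|inc s h w|)%:E = A s * A h)%E.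
Proof.
move=> s0 h0; rewrite -(incA s0 h0).
apply: (integral_mul_independent_pair (f := fun x => `|x|) (g := fun x => `|x|)) => //.
by apply: levy_increment_independent => //; rewrite lerDl.
Qed.

Let mabs s : measurable_fun setT (fun w => `|X s w|).
Proof. exact: measurableT_comp. Qed.

Let minc_abs s h : measurable_fun setT (fun w => `|inc s h w|).
Proof. exact: measurableT_comp. Qed.

(** The process is nonnegative only almost surely, as is the case of a Poisson
process. Absolute values keep all the integrands nonnegative everywhere, and
add up along the increments. *)
Let abs_inc s h : 0 <= s -> 0 <= h ->
  {ae P, forall w, `|X (s + h) w| = `|X s w| + `|inc s h w|}.
Proof.
move=> s0 h0; move: (X_ge0 s0) (inc_ge0 s0 h0); apply: filterS2 => w h1 h2.
by rewrite !ger0_norm// /inc ?subrKC//; move: h2; rewrite /inc; lra.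
Qed.

Let AD s h : 0 <= s -> 0 <= h -> A (s + h) = (A s + A h)%E.
Proof.
move=> s0 h0; rewrite -(incA s0 h0) /A -ge0_integralD_EFin//.
apply: ae_eq_integral_EFin => //; last exact: abs_inc.
exact: measurable_funD.
Qed.

Let BD s h : 0 <= s -> 0 <= h ->
  B (s + h) = (B s + 2%:E * (A s * A h) + B h)%E.
Proof.
move=> s0 h0; rewrite -incAA// -(incB s0 h0) /B.
have m2 (f : T -> R) : measurable_fun setT f ->
    measurable_fun setT (fun w => f w ^+ 2) by exact: measurable_funX.
have m12 : measurable_fun setT (fun w => `|X s w| * `|inc s h w|).
  exact: measurable_funM.
have m12' : measurable_fun setT (fun w => 2 * (`|X s w| * `|inc s h w|)).
  exact: measurable_funM.
have sq0 (f : T -> R) w : 0 <= f w ^+ 2 by exact: sqr_ge0.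
rewrite -ge0_integralM_EFin//.
rewrite -ge0_integralD_EFin//; last exact: m2.
rewrite -ge0_integralD_EFin//; last 3 first.
- by apply: measurable_funD => //; exact: m2.
- exact: m2.
- by move=> w; rewrite addr_ge0// !mulr_ge0.
apply: ae_eq_integral_EFin => //.
- exact: m2.
- by apply: measurable_funD; [apply: measurable_funD|] => //; exact: m2.
- by move=> w; rewrite !addr_ge0// !mulr_ge0.
- apply: filterS (abs_inc s0 h0) => w e.
  rewrite -[LHS]real_normK ?num_real// e.
  rewrite -[X in _ = X + _ + _]real_normK ?num_real//.
  by rewrite -[X in _ = _ + X]real_normK ?num_real//; ring.
Qed.

Let CD s h : 0 <= s -> 0 <= h -> C s (s + h) = (B s + A s * A h)%E.
Proof.
move=> s0 h0; rewrite -incAA// /B /C.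
rewrite -ge0_integralD_EFin//; last 3 first.
- exact: measurable_funX.
- exact: measurable_funM.
- by move=> w; exact: sqr_ge0.
apply: ae_eq_integral_EFin => //.
- exact/measurableT_comp/measurable_funM.
- by apply: measurable_funD; [exact: measurable_funX|exact: measurable_funM].
- by move=> w; rewrite addr_ge0 ?sqr_ge0// mulr_ge0.
- apply: filterS (abs_inc s0 h0) => w e.
  rewrite normrM e -[X in _ = X + _]real_normK ?num_real//; ring.
Qed.

(** The mean is additive in time because increments are stationary; the variance
is additive too because they are independent. Both are nonnegative, hence
linear. *)
Lemma levy_moments : exists m v : R, [/\ 0 <= m, 0 <= v,
  forall t, 0 <= t -> (\int[P]_w `|X t w|%:E = (m * t)%:E)%E &
  forall s t, 0 <= s -> s <= t ->
    (\int[P]_w `|X s w * X t w|%:E = (v * s + m ^+ 2 * s * t)%:E)%E].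
Proof.
have B_fin t : 0 <= t -> B t \is a fin_num.
  move=> t0; rewrite ge0_fin_numE ?X_sqr// integral_ge0// => w _.
  by rewrite lee_fin sqr_ge0.
have A_fin t : 0 <= t -> A t \is a fin_num.
  move=> t0; rewrite ge0_fin_numE; last by apply: integral_ge0.
  (* a square-integrable variable is integrable, by |x| <= 1 + x^2 *)
  apply: (@le_lt_trans _ _ (\int[P]_w (1 + X t w ^+ 2)%:E)%E).
    apply: ge0_le_integral => //.
    - exact/measurable_EFinP/measurableT_comp.
    - by apply/measurable_EFinP/measurable_funD => //; exact: measurable_funX.
    - move=> w _; rewrite lee_fin -(real_normK (num_real (X t w))).
      have := normr_ge0 (X t w); have := sqr_ge0 (`|X t w| - 1); nra.
  under eq_integral do rewrite EFinD.
  rewrite ge0_integralD//.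
  - by rewrite integral_cst_probability lte_add_pinfty ?ltry// X_sqr.
  - by move=> w _; rewrite lee_fin sqr_ge0.
  - exact/measurable_EFinP/measurable_funX.
pose a t := fine (A t); pose b t := fine (B t).
have AE t : 0 <= t -> A t = (a t)%:E by move=> t0; rewrite fineK ?A_fin.
have BE t : 0 <= t -> B t = (b t)%:E by move=> t0; rewrite fineK ?B_fin.
have aD s h : 0 <= s -> 0 <= h -> a (s + h) = a s + a h.
  move=> s0 h0; apply: EFin_inj.
  by rewrite EFinD -!AE ?addr_ge0// AD.
have bD s h : 0 <= s -> 0 <= h -> b (s + h) = b s + 2 * (a s * a h) + b h.
  move=> s0 h0; apply: EFin_inj.
  by rewrite 2!EFinD 2!EFinM -!AE -?BE ?addr_ge0// BD.
have a0 t : 0 <= a t.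
  by rewrite fine_ge0// integral_ge0.
have b0 t : 0 <= t -> a t ^+ 2 <= b t.
  move=> t0; apply: (@le_integral_sqr _ _ _ P (fun w => `|X t w|)) => //.
  - exact: AE.
  - rewrite -BE//; apply: eq_integral => w _.
    by rewrite real_normK ?num_real.
have alin := additive_ge0_linear aD (fun t _ => a0 t).
have vlin t : 0 <= t -> b t - a t ^+ 2 = (b 1 - a 1 ^+ 2) * t.
  apply: (additive_ge0_linear (f := fun t => b t - a t ^+ 2)).
  - by move=> s h s0 h0; rewrite aD// bD//; ring.
  - by move=> u u0; rewrite subr_ge0 b0.
exists (a 1), (b 1 - a 1 ^+ 2); split => //.
- by rewrite subr_ge0 b0.
- by move=> t t0; rewrite -alin//; exact: AE.
- move=> s t s0 st; have ts0 : 0 <= t - s by rewrite subr_ge0.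
  have := CD s0 ts0; rewrite subrKC /C => ->.
  rewrite !AE// BE// -EFinM -EFinD; congr EFin.
  rewrite (alin _ ts0) (alin _ s0).
  have := vlin _ s0; rewrite (alin _ s0) => e.
  have -> : b s = (b 1 - a 1 ^+ 2) * s + (a 1 * s) ^+ 2 by rewrite -e; ring.
  ring.
Qed.

End levy_moments.

(** * Laplace transforms determine laws *)

Section laplace_uniqueness.
Context {R : realType}.

Lemma bernoulli_inequality (y : R) (n : nat) : 0 <= y <= 1 ->
  1 - n%:R * y <= (1 - y) ^+ n.
Proof.
move=> /andP[y0 y1]; elim: n => [|n IH]; first by rewrite mul0r subr0 expr0.
rewrite exprS; apply: (@le_trans _ _ ((1 - y) * (1 - n%:R * y))); last first.
  by rewrite ler_wpM2l// subr_ge0.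
rewrite -natr1; have : 0 <= n%:R :> R by []; nra.
Qed.

(** With r = q^2, the sequence n q^n is bounded because (1/q)^n grows at least
linearly, and the other factor q^n tends to 0. *)
Lemma cvg_natmul_expr (r : R) : 0 <= r < 1 ->
  n%:R * r ^+ n @[n --> \oo] --> 0.
Proof.
move=> /andP[]; rewrite le_eqVlt => /predU1P[<- _|r0 r1].
  rewrite -(cvg_shiftn 1)/=; under eq_fun do rewrite addn1 expr0n/= mulr0.
  exact: cvg_cst.
pose q := Num.sqrt r.
have q0 : 0 < q by rewrite sqrtr_gt0.
have rq : r = q * q by rewrite -expr2 sqr_sqrtr// ltW.
have q1 : q < 1 by nra.
have qV : 0 < q^-1 - 1 by rewrite subr_gt0 invf_gt1.
have bound n : n%:R * q ^+ n <= (q^-1 - 1)^-1.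
  have h : n%:R * (q^-1 - 1) <= q^-1 ^+ n.
    elim: n => [|n IH]; first by rewrite mul0r.
    rewrite -natr1 mulrDl mul1r exprS.
    have : 1 <= q^-1 ^+ n by rewrite exprn_ege1// ltW// invf_gt1.
    nra.
  rewrite -[leRHS]mul1r ler_pdivlMr// mulrAC -ler_pdivlMr ?exprn_gt0//.
  by rewrite mul1r -exprVn.
apply: (@squeeze_cvgr _ _ _ _ (cst 0) (fun n => (q^-1 - 1)^-1 * q ^+ n)).
- apply: nearW => n /=; rewrite mulr_ge0 ?exprn_ge0 ?(ltW r0)//=.
  by rewrite rq exprMn mulrA ler_wpM2r ?exprn_ge0 ?(ltW q0).
- exact: cvg_cst.
- rewrite -[X in _ --> X](mulr0 (q^-1 - 1)^-1); apply: cvgM; first exact: cvg_cst.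
  by apply: cvg_expr; rewrite ger0_norm// ltW.
Qed.

(** For z in [0, 1], the value at z behaves like exp(- n (2 z)^n), hence tends to
1 if z < 1/2 and to 0 if z >= 1/2. This explicit sequence approximates a step
function by polynomials, uniformly bounded on [0, 1]. *)
Definition threshold_poly n : {poly R} := (1 - 'X^n) ^+ (n * 2 ^ n).

Lemma threshold_polyE n (z : R) :
  (threshold_poly n).[z] = (1 - z ^+ n) ^+ (n * 2 ^ n).
Proof. by rewrite horner_exp !hornerE. Qed.

Lemma threshold_poly_itv n (z : R) : 0 <= z <= 1 ->
  0 <= (threshold_poly n).[z] <= 1.
Proof.
move=> /andP[z0 z1]; have zn1 := exprn_ile1 n z0 z1.
have zn0 := exprn_ge0 n z0.
by rewrite threshold_polyE exprn_ge0 ?exprn_ile1 ?subr_ge0// lerBlDr lerDl.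
Qed.

Lemma threshold_poly_cvg (z : R) : 0 <= z <= 1 ->
  (threshold_poly n).[z] @[n --> \oo] --> ((z < 2^-1)%R%:R : R).
Proof.
move=> z01; have /andP[z0 z1] := z01.
have zn n : 0 <= z ^+ n <= 1 by rewrite exprn_ge0//= exprn_ile1.
case: ltP => z2 /=.
  apply: (@squeeze_cvgr _ _ _ _ (fun n => 1 - n%:R * (2 * z) ^+ n) (cst 1)).
  - apply: nearW => n; have /andP[_ ->] := threshold_poly_itv n z01.
    rewrite andbT threshold_polyE; apply: le_trans (bernoulli_inequality _ (zn n)).
    by rewrite natrM natrX exprMn mulrA.
  - rewrite -[X in _ --> X](subr0 1); apply: cvgB; first exact: cvg_cst.
    by apply: cvg_natmul_expr; rewrite mulr_ge0//=; lra.
  - exact: cvg_cst.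
apply: (@squeeze_cvgr _ _ _ _ (cst 0) (fun n => expR (- 1) ^+ n)).
- apply: nearW => n; have /andP[-> _] := threshold_poly_itv n z01 => /=.
  rewrite threshold_polyE; have /andP[zn0 zn1] := zn n.
  apply: (@le_trans _ _ (expR (- z ^+ n) ^+ (n * 2 ^ n))).
    by rewrite lerXn2r ?nnegrE ?subr_ge0 ?expR_ge0// expR_ge1Dx.
  rewrite -!expRM_natl ler_expR mulrN mulrN1 lerN2 natrM natrX -mulrA.
  by rewrite ler_peMr// -exprMn exprn_ege1//; lra.
- exact: cvg_cst.
- by apply: cvg_expr; rewrite ger0_norm ?expR_ge0// expR_lt1; lra.
Qed.

Context {d : measure_display} {T : measurableType d} (P : probability T R).

(** With s = ln 2 / x one has Z > x if and only if exp(- s Z) < 1/2. The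
threshold polynomials evaluated at exp(- s Z) thus converge boundedly to the
indicator of Z > x, and their expectations are combinations of values of the
Laplace transform of Z. *)
Lemma laplace_transform_unique (X Y : T -> R) :
  measurable_fun setT X -> measurable_fun setT Y ->
  (forall w, 0 <= X w) -> (forall w, 0 <= Y w) ->
  (forall s, 0 < s -> (\int[P]_w (expR (- (s * X w)))%:E =
                       \int[P]_w (expR (- (s * Y w)))%:E)%E) ->
  forall x, 0 < x -> P (X @^-1` `]x, +oo[) = P (Y @^-1` `]x, +oo[).
Proof.
move=> mX mY X0 Y0 XY x x0.
pose s := ln 2 / x; have s0 : 0 < s by rewrite divr_gt0// ln_gt0// ltr1n.
have main (Z : T -> R) : measurable_fun setT Z -> (forall w, 0 <= Z w) ->
    (\int[P]_w ((threshold_poly n).[expR (- (s * Z w))])%:E)%E @[n --> \oo] -->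
    P (Z @^-1` `]x, +oo[).
  move=> mZ Z0.
  have z01 w : 0 <= expR (- (s * Z w)) <= 1.
    by rewrite expR_ge0 expR_le1 oppr_le0 mulr_ge0// ltW.
  have mx : measurable (Z @^-1` `]x, +oo[) by exact: measurable_preimage.
  rewrite (_ : P _ = \int[P]_w (\1_(Z @^-1` `]x, +oo[) w)%:E)%E; last first.
    by rewrite integral_indic// setIT.
  apply: (@dominated_cvg _ _ _ P setT measurableT _ _ (cst 1%E)) => //.
  - move=> n; apply/measurable_EFinP.
    under eq_fun do rewrite threshold_polyE.
    apply: measurable_funX; apply: measurable_funB => //.
    apply: measurable_funX; apply: measurableT_comp => //.
    apply: measurableT_comp => //; exact: measurable_funM.
  - move=> w _; apply: cvg_EFin; first exact: nearW.
    have := threshold_poly_cvg (z01 w).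
    rewrite indicE (_ : (expR _ < 2^-1) = (w \in Z @^-1` `]x, +oo[))//.
    rewrite -[2^-1 in LHS]lnK ?posrE// ltr_expR lnV ?posrE// ltrN2 /s.
    have ln2 : 0 < ln 2 :> R by rewrite ln_gt0// ltr1n.
    have -> : (ln 2 < ln 2 / x * Z w) = (x < Z w).
      by rewrite mulrAC ltr_pdivlMr// ltr_pM2l.
    by apply/idP/idP; rewrite inE/= in_itv/= andbT.
  - exact: finite_measure_integrable_cst.
  - move=> n w _; have /andP[h0 h1] := threshold_poly_itv n (z01 w).
    by rewrite gee0_abs lee_fin.
have poly_eq (p : {poly R}) : (\int[P]_w (p.[expR (- (s * X w))])%:E =
    \int[P]_w (p.[expR (- (s * Y w))])%:E)%E.
  have monom (Z : T -> R) (k : nat) : measurable_fun setT Z ->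
      (forall w, 0 <= Z w) ->
      P.-integrable setT (fun w => (p`_k * expR (- (s * Z w)) ^+ k)%:E).
    move=> mZ Z0.
    apply: (@le_integrable _ _ _ _ _ measurableT _ (cst (p`_k)%:E)) => //.
    - apply/measurable_EFinP/measurable_funM => //.
      apply: measurable_funX; apply: measurableT_comp => //.
      apply: measurableT_comp => //; exact: measurable_funM.
    - move=> w _; rewrite /= lee_fin normrM ler_piMr// ger0_norm.
        by rewrite exprn_ile1 ?expR_ge0// expR_le1 oppr_le0 mulr_ge0// ltW.
      by rewrite exprn_ge0 ?expR_ge0.
    - exact: finite_measure_integrable_cst.
  have expand (Z : T -> R) : measurable_fun setT Z -> (forall w, 0 <= Z w) ->
      (\int[P]_w (p.[expR (- (s * Z w))])%:E =
       \sum_(k < size p) (p`_k)%:E * \int[P]_w (expR (- (s * Z w)) ^+ k)%:E)%E.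
    move=> mZ Z0; under eq_integral do rewrite horner_coef -sumEFin.
    rewrite integral_sum//; last by move=> k; exact: monom.
    apply: eq_bigr => k _; under eq_integral do rewrite EFinM.
    rewrite integralZl//.
    apply: (@le_integrable _ _ _ _ _ measurableT _ (cst 1%:E)) => //.
    - apply/measurable_EFinP.
      apply: measurable_funX; apply: measurableT_comp => //.
      apply: measurableT_comp => //; exact: measurable_funM.
    - move=> w _; rewrite /= lee_fin normr1 ger0_norm.
        by rewrite exprn_ile1 ?expR_ge0// expR_le1 oppr_le0 mulr_ge0// ltW.
      by rewrite exprn_ge0 ?expR_ge0.
    - exact: finite_measure_integrable_cst.
  rewrite (expand _ mX X0) (expand _ mY Y0); apply: eq_bigr => k _; congr (_ * _)%E.
  have [->|k0] := posnP k.
    by under eq_integral do rewrite expr0; rewrite [RHS](eq_integral (cst 1%E)).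
  have powE (Z : T -> R) : (\int[P]_w (expR (- (s * Z w)) ^+ k)%:E =
      \int[P]_w (expR (- (k%:R * s * Z w)))%:E)%E.
    by apply: eq_integral => w _; rewrite -expRM_natl mulrN mulrA.
  by rewrite !powE XY// mulr_gt0// ltr0n.
have := main _ mX X0; under eq_fun do rewrite poly_eq.
move=> XP.
exact: cvg_unique XP (main _ mY Y0).
Qed.

End laplace_uniqueness.

(** * The inverse of a subordinator *)

Section inverse_subordinator.
Context {d : measure_display} {T : measurableType d} {R : realType}.
Variables (P : probability T R) (D : R -> {RV P >-> R}).

(** [inverse_process D t w] is the infimum of this set. *)
Definition passage_times t w := [set s : R | 0 < s /\ t < D s w].

Hypothesis subD : subordinator D.

Local Notation E := (inverse_process D).
Local Notation passed := passage_times.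

Let passed_has_lbound t w : has_lbound (passed t w).
Proof. by exists 0 => s [/ltW]. Qed.

Lemma subordinator_ge0 t w : 0 <= t -> 0 <= D t w.
Proof.
move=> t0; rewrite -(levy_start (subordinator_levy subD) w).
exact: (subordinator_nd subD).
Qed.

Lemma inverse_process_ge0 t w : 0 <= E t w.
Proof.
have [e0|/set0P ne0] := eqVneq (passed t w) set0.
  by rewrite /inverse_process -/(passed t w) e0 inf0.
by apply: lb_le_inf => // s [/ltW].
Qed.

Lemma lt_inverse_process t s w : 0 < s -> s < E t w -> D s w <= t.
Proof.
move=> s0 sE; rewrite leNgt; apply/negP => tD.
have : E t w <= s by apply: (ge_inf (passed_has_lbound t w)).
by apply/negP; rewrite -ltNge.
Qed.

Lemma le_inverse_process t s w : 0 <= s -> passed t w !=set0 ->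
  D s w <= t -> s <= E t w.
Proof.
move=> s0 ne Ds; apply: lb_le_inf => // r [r0 tD].
rewrite leNgt; apply/negP => rs.
by have := subordinator_nd subD w (ltW r0) (ltW rs); lra.
Qed.

Lemma le_inverse_process2 u v w : u <= v -> passed v w !=set0 ->
  E u w <= E v w.
Proof.
move=> uv ne; apply: lb_le_inf => // s [s0 vD].
apply: (ge_inf (passed_has_lbound u w)); split => //.
exact: le_lt_trans vD.
Qed.

Lemma passedP t w : passed t w !=set0 <-> exists n : nat, t < D n%:R w.
Proof.
split=> [[s [s0 tD]]|[n tD]].
  exists (Num.truncn s).+1; apply: lt_le_trans tD _.
  apply: (subordinator_nd subD); first exact: ltW.
  by have /andP[_ /ltW] := truncn_itv (ltW s0).
exists n.+1%:R; split; first exact: ltr0Sn.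
by apply: lt_le_trans tD _; apply: (subordinator_nd subD); rewrite ?ler_nat.
Qed.

(** Countably many constraints on D describe a strict lower bound on E. The time
must be strictly after a since D may exceed t immediately after a. The set of
passage times must be nonempty since the infimum of the empty set is 0. *)
Lemma inverse_process_itv t a w : 0 <= a ->
  (a < E t w) <->
  passed t w !=set0 /\ exists n : nat, D (a + n.+1%:R^-1) w <= t.
Proof.
move=> a0; split=> [aE|[ne [n Dt]]].
  split.
    apply/set0P/negP => /eqP e0; move: aE.
    by rewrite /inverse_process -/(passed t w) e0 inf0 ltNge a0.
  pose e := (E t w - a) / 2.
  have e0 : 0 < e by rewrite divr_gt0// subr_gt0.
  exists (Num.truncn e^-1).
  have eV0 : 0 <= e^-1 by rewrite invr_ge0 ltW.
  have /andP[_ te] := truncn_itv eV0.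
  have ne : (Num.truncn e^-1).+1%:R^-1 < e by rewrite invf_plt ?posrE.
  apply: lt_inverse_process; first by rewrite ltr_wpDl.
  apply: (@lt_trans _ _ (a + e)); first by rewrite ltrD2l.
  by rewrite /e; lra.
have n0 : 0 < n.+1%:R^-1 :> R by rewrite invr_gt0.
apply: lt_le_trans (le_inverse_process _ ne Dt); first by rewrite ltrDl.
by rewrite addr_ge0// ltW.
Qed.

Lemma measurable_subordinator_le s t : measurable [set w | D s w <= t].
Proof.
exact: measurable_set_le.
Qed.

Lemma measurable_passed t : measurable [set w | passed t w !=set0].
Proof.
rewrite [X in measurable X](_ : _ = \bigcup_n ~` [set w | D n%:R w <= t]).
  apply: bigcupT_measurable => n; apply: measurableC.
  exact: measurable_subordinator_le.
apply/seteqP; split => w /=.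
  by move=> /passedP[n tD]; exists n => //=; apply/negP; rewrite -ltNge.
by move=> [n _ /= /negP]; rewrite -ltNge => tD; apply/passedP; exists n.
Qed.

Lemma measurable_inverse_process t : measurable_fun setT (E t).
Proof.
apply: (measurability _ (RGenOInfty.measurableE R)) => _ [_ [a ->] <-].
rewrite setTI; have [a0|a0] := leP 0 a; last first.
  rewrite [X in measurable X](_ : _ = setT)//.
  apply/seteqP; split => // w _ /=; rewrite in_itv/= andbT.
  exact: lt_le_trans a0 (inverse_process_ge0 _ _).
rewrite [X in measurable X](_ : _ = [set w | passed t w !=set0] `&`
    \bigcup_n [set w | D (a + n.+1%:R^-1) w <= t]).
  apply: measurableI; first exact: measurable_passed.
  by apply: bigcupT_measurable => n; exact: measurable_subordinator_le.
apply/seteqP; split => w /=; rewrite in_itv/= andbT.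
  by move=> /(inverse_process_itv _ _ a0)[ne [n Dn]]; split => //; exists n.
by move=> [ne [n _ Dn]]; apply/(inverse_process_itv _ _ a0); split => //; exists n.
Qed.

Hypothesis escapes : forall t : R, {ae P, forall w, passed t w !=set0}.

Local Open Scope ereal_scope.

(** The events on the left increase to the one on the right. The factor k leaves
room for writing c = a + b and shifting a and b separately, with k = 2. *)
Lemma inverse_process_joint_tail (k : nat) (u v a c : R) : (0 < k)%N ->
    (0 <= a)%R -> (0 <= c)%R ->
  P [set w | (D (a + n.+1%:R^-1)%R w <= u)%R /\
             (D (c + k%:R * n.+1%:R^-1)%R w <= v)%R] @[n --> \oo] -->
  P [set w | (a < E u w)%R /\ (c < E v w)%R].
Proof.
move=> k0 a0 c0.
pose S n := [set w | (D (a + n.+1%:R^-1)%R w <= u)%R /\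
                     (D (c + k%:R * n.+1%:R^-1)%R w <= v)%R].
have mS n : measurable (S n).
  exact: measurableI (measurable_subordinator_le _ _)
                     (measurable_subordinator_le _ _).
have mE (a' t : R) : measurable [set w | (a' < E t w)%R].
  by apply: measurable_set_gt; exact: measurable_inverse_process.
rewrite (_ : P _ = P (\bigcup_n S n)).
  apply: nondecreasing_cvg_mu => //.
    by apply: bigcupT_measurable.
  move=> m n mn; apply/subsetPset => w [Su Sv].
  have nm : (n.+1%:R^-1 <= m.+1%:R^-1 :> R)%R by rewrite lef_pV2 ?posrE// ler_nat.
  have n0 : (0 <= n.+1%:R^-1 :> R)%R by rewrite invr_ge0.
  split; [apply: le_trans Su|apply: le_trans Sv];
    apply: (subordinator_nd subD).
  - by rewrite addr_ge0.
  - by rewrite lerD2l.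
  - by rewrite addr_ge0// mulr_ge0.
  - by rewrite lerD2l ler_wpM2l.
apply: measure_ae_eq.
- exact: measurableI (mE _ _) (mE _ _).
- exact: bigcupT_measurable.
move: (escapes u) (escapes v); apply: filterS2 => w pu pv; split.
  move=> [/(inverse_process_itv _ _ a0)[_ [m Dm]]
          /(inverse_process_itv _ _ c0)[_ [j Dj]]].
  exists (maxn m (k * j.+1)) => //; split.
    apply: le_trans Dm; apply: (subordinator_nd subD).
      by rewrite addr_ge0.
    by rewrite lerD2l lef_pV2 ?posrE// ler_nat ltnS leq_maxl.
  apply: le_trans Dj; apply: (subordinator_nd subD).
    by rewrite addr_ge0// mulr_ge0.
  rewrite lerD2l -ler_pdivlMl ?ltr0n// -invfM lef_pV2 ?posrE ?mulr_gt0 ?ltr0n//.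
  by rewrite -natrM ler_nat leqW// leq_maxr.
move=> [n _ [Su Sv]]; split.
  by apply/(inverse_process_itv _ _ a0); split => //; exists n.
apply/(inverse_process_itv _ _ c0); split => //; exists n.
apply: le_trans Sv; apply: (subordinator_nd subD).
  by rewrite addr_ge0.
by rewrite lerD2l ler_peMl// ler1n.
Qed.

Lemma inverse_process_tail (t a : R) : (0 <= a)%R ->
  P [set w | (D (a + n.+1%:R^-1)%R w <= t)%R] @[n --> \oo] -->
  P [set w | (a < E t w)%R].
Proof.
move=> a0; have := @inverse_process_joint_tail 1%N t t a a isT a0 a0.
have setII_id (A : set T) : [set w | A w /\ A w] = A.
  by apply/seteqP; split => w //= [].
rewrite (setII_id [set w | (a < E t w)%R]).
under eq_fun => n do rewrite div1r.
under eq_fun => n do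
  rewrite (setII_id [set w | (D (a + n.+1%:R^-1)%R w <= t)%R]).
by [].
Qed.

End inverse_subordinator.

(** * Self-similarity of the inverse stable subordinator *)

Lemma ex_nat_gt {R : realType} (x : R) : exists n : nat, x < n.+1%:R.
Proof.
have [x0|x0] := leP 0 x.
  by exists (Num.truncn x); have /andP[] := truncn_itv x0.
by exists 0%N; apply: lt_le_trans x0 _.
Qed.

Section stable_inverse.
Context {d : measure_display} {T : measurableType d} {R : realType}.
Variables (P : probability T R) (beta : R) (D : R -> {RV P >-> R}).
Hypothesis beta01 : 0 < beta < 1.
Hypothesis D_stable : stable_subordinator beta D.

Let subD : subordinator D := stable_sub D_stable.
Local Notation E := (inverse_process D).

Local Open Scope ereal_scope.

Let laplaceD (s t : R) : (0 < s)%R -> (0 <= t)%R ->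
  \int[P]_w (expR (- (s * D t w)))%:E = (expR (- (t * s `^ beta)))%:E.
Proof.
by move=> s0 t0; rewrite -(stable_laplace D_stable)// unlock.
Qed.

Let mexp (s t : R) : measurable_fun setT (fun w => expR (- (s * D t w))).
Proof.
apply: measurableT_comp => //; apply: measurableT_comp => //.
exact: measurable_funM.
Qed.

(** Markov's inequality for exp(- D_s). *)
Lemma stable_small_ball (s t : R) : (0 <= s)%R ->
  P [set w | (D s w <= t)%R] <= (expR (t - s))%:E.
Proof.
move=> s0; rewrite -[X in P X]setIT -integral_indic//; last first.
  exact: measurable_subordinator_le.
have := laplaceD ltr01 s0; rewrite powR1 mulr1 => h.
rewrite expRD EFinM -h -ge0_integralM_EFin ?expR_ge0//.
apply: ge0_le_integral_EFin => //.
- by apply: measurable_indic; exact: measurable_subordinator_le.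
- exact: measurable_funM.
- move=> w; rewrite indicE; have [/set_mem/= Dt|_] := boolP (_ \in _).
    by rewrite -expRD mul1r -[leLHS]expR0 ler_expR subr_ge0.
  by rewrite mulr_ge0 ?expR_ge0.
Qed.

(** D_n <= t has probability at most exp(t - n), for all n. *)
Lemma stable_escapes (t : R) :
  {ae P, forall w, passage_times D t w !=set0}.
Proof.
pose A := [set w | passage_times D t w !=set0].
have mA : measurable A by exact: measurable_passed.
suff : P (~` A) = 0.
  by move=> PA; apply/(negligibleP _ (measurableC mA)).
apply/eqP; rewrite eq_le measure_ge0 andbT.
have fin : P (~` A) \is a fin_num by apply: fin_num_measure; exact: measurableC.
have bound n : P (~` A) <= (expR (t - n%:R))%:E.
  apply: le_trans (stable_small_ball t (ler0n R n)).
  apply: le_measure; rewrite ?inE//.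
  - exact: measurableC.
  - exact: measurable_subordinator_le.
  - move=> w /= nA; rewrite leNgt; apply/negP => tD.
    by apply: nA; apply/(passedP subD); exists n.
rewrite -(fineK fin) lee_fin leNgt; apply/negP => r0.
have [n nP] := ex_nat_gt (expR t / fine (P (~` A))).
have := bound n.+1; rewrite -(fineK fin) lee_fin expRB.
rewrite leNgt => /negP; apply.
rewrite ltr_pdivrMr ?expR_gt0//.
move: nP; rewrite ltr_pdivrMr// mulrC => /lt_le_trans; apply.
rewrite ler_wpM2l ?(ltW r0)//; apply: le_trans (expR_ge1Dx _).
by rewrite lerDr.
Qed.

Let mE t : measurable_fun setT (E t).
Proof. exact: measurable_inverse_process. Qed.

Let mgt (t a : R) : measurable [set w | (a < E t w)%R].
Proof.
exact: measurable_set_gt.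
Qed.

Let mle (s t : R) := measurable_subordinator_le D s t.

Lemma inverse_tail_ge (t a s : R) : (0 <= a)%R -> (a < s)%R ->
  P [set w | (D s w <= t)%R] <= P [set w | (a < E t w)%R].
Proof.
move=> a0 as_; apply: measure_ae_le; [exact: mle|exact: mgt|].
apply: filterS (stable_escapes t) => w ne Dt.
by apply: lt_le_trans (le_inverse_process subD _ ne Dt) => //; apply: le_trans (ltW as_).
Qed.

Lemma inverse_tail_le (t a : R) : (0 < a)%R ->
  P [set w | (a < E t w)%R] <= P [set w | (D a w <= t)%R].
Proof.
move=> a0; apply: le_measure; rewrite ?inE; [exact: mgt|exact: mle|].
by move=> w; exact: lt_inverse_process.
Qed.

(** Both variables have the Laplace transform exp(- s u^beta). *)
Let stable_scaling (c s t : R) : (0 < c)%R -> (0 <= s)%R -> (0 < t)%R ->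
  P [set w | (D (c `^ beta * s) w <= c * t)%R] = P [set w | (D s w <= t)%R].
Proof.
move=> c0 s0 t0.
have cs0 : (0 <= c `^ beta * s)%R by rewrite mulr_ge0 ?powR_ge0.
have compl (X : T -> R) (x : R) : measurable_fun setT X ->
    P [set w | (X w <= x)%R] = 1 - P (X @^-1` `]x, +oo[).
  move=> mX; rewrite -probability_setC; last exact: measurable_preimage.
  congr (P _); apply/seteqP; split => w /=; rewrite in_itv/= andbT leNgt.
    by move/negP.
  by move/negP.
have -> : [set w | (D (c `^ beta * s) w <= c * t)%R] =
    [set w | (c^-1 * D (c `^ beta * s)%R w <= t)%R].
  by apply/seteqP; split => w /=; rewrite ler_pdivrMl.
rewrite !compl//; last exact: measurable_funM.
congr (_ - _); apply: laplace_transform_unique => //.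
- exact: measurable_funM.
- by move=> w; rewrite mulr_ge0 ?invr_ge0 ?(ltW c0)// subordinator_ge0.
- by move=> w; rewrite subordinator_ge0.
- move=> u u0; under eq_integral do rewrite mulrA.
  rewrite (laplaceD (divr_gt0 u0 c0) cs0) (laplaceD u0 s0); congr (expR (- _))%:E.
  rewrite mulrAC mulrC; congr (_ * _)%R.
  rewrite -powRM ?divr_ge0 ?(ltW u0) ?(ltW c0)//.
  by rewrite mulrC divfK// gt_eqF.
Qed.

(** Tails of E and of D can only be compared at a slightly larger time, whence
one inequality after a passage to the limit; the reverse inequality is the same
one for the ratio 1/c. *)
Lemma inverse_tail_scaling (c t a : R) : (0 < c)%R -> (0 < t)%R -> (0 <= a)%R ->
  P [set w | (c `^ beta * a < E (c * t) w)%R] = P [set w | (a < E t w)%R].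
Proof.
move: c t a.
have half (c t a : R) : (0 < c)%R -> (0 < t)%R -> (0 <= a)%R ->
    P [set w | (a < E t w)%R] <= P [set w | (c `^ beta * a < E (c * t) w)%R].
  move=> c0 t0 a0.
  have cb : (0 < c `^ beta)%R by rewrite powR_gt0.
  have h := @inverse_process_tail _ _ _ _ _ subD stable_escapes t a a0.
  rewrite -(cvg_lim _ h)//; apply: lime_le; first by apply/cvg_ex; eexists; exact: h.
  apply: nearW => n; rewrite -(stable_scaling c0 _ t0) ?addr_ge0//.
  apply: inverse_tail_ge; first by rewrite mulr_ge0// ltW.
  by rewrite ltr_pM2l// ltrDl.
move=> c t a c0 t0 a0; apply/eqP; rewrite eq_le half// andbT.
have cb : (0 <= c `^ beta * a)%R by rewrite mulr_ge0 ?powR_ge0.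
have := half c^-1%R (c * t)%R _ _ _ cb.
rewrite invr_gt0 c0 mulr_gt0// => /(_ isT isT).
by rewrite !mulrA -powRM ?invr_ge0 ?(ltW c0)// mulVf ?gt_eqF// powR1 !mul1r.
Qed.

End stable_inverse.

(** * Two-time tails of the inverse stable subordinator *)

Section overshoot_kernel.
Context {R : realType}.

(** The length of the set of all b >= 0 such that a < x and a + b < y, that is
the integral over b of the indicator of the event that appears in
[inverse_joint_tail_bounds]; negative a are discarded. *)
Definition overshoot_kernel (x y a : R) : R :=
  if (0 <= a) && (a < x) then Num.max (y - a) 0 else 0.

Lemma overshoot_kernel_ge0 x y a : 0 <= overshoot_kernel x y a.
Proof. by rewrite /overshoot_kernel; case: ifP => //; rewrite le_max lexx orbT. Qed.

Lemma measurable_overshoot_kernel {d} {T : measurableType d} (X Y A : T -> R) :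
  measurable_fun setT X -> measurable_fun setT Y -> measurable_fun setT A ->
  measurable_fun setT (fun w => overshoot_kernel (X w) (Y w) (A w)).
Proof.
move=> mX mY mA; apply: measurable_fun_ifT => //.
  by apply: measurable_and; [exact: measurable_fun_ler|exact: measurable_fun_ltr].
by apply: measurable_maxr => //; exact: measurable_funB.
Qed.

Lemma integral_overshoot_kernel (x y : R) : 0 <= x -> x <= y ->
  (\int[lebesgue_measure]_a (overshoot_kernel x y a)%:E =
   (x * y - x ^+ 2 / 2)%:E)%E.
Proof.
move=> x0 xy.
transitivity (\int[lebesgue_measure]_(a in `[0%R, x[) (y - a)%:E)%E.
  rewrite [RHS]integral_mkcond; apply: eq_integral => a _.
  rewrite patchE /overshoot_kernel mem_setE in_itv/=; case: ifPn => // /andP[a0 ax].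
  by rewrite max_l// subr_ge0 ltW// (lt_le_trans ax).
have [->|xn0] := eqVneq x 0.
  by rewrite set_itvco0 integral_set0 mul0r expr0n/= mul0r subr0.
have {xn0}x0 : 0 < x by rewrite lt_neqAle eq_sym xn0.
have F' (a : R) : is_derive a 1 (fun a : R => y * a - a ^+ 2 / 2 : R) (y - a).
  apply: is_derive_eq; rewrite /GRing.scale/=; by field.
have F1 (a : R) : derivable (fun a : R => y * a - a ^+ 2 / 2 : R) a 1 by [].
rewrite integral_itv_bndo_bndc; last first.
  by apply: measurable_funTS; apply/measurable_EFinP; exact: measurable_funB.
rewrite (@continuous_FTC2 _ _ (fun a => y * a - a ^+ 2 / 2))//.
- by rewrite mulr0 expr0n/= mul0r subr0 sube0 mulrC.
- apply: continuous_subspaceT => a; apply: cvgB; [exact: cvg_cst|exact: cvg_id].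
- have cF : continuous (fun a : R => y * a - a ^+ 2 / 2 : R).
    by move=> a; apply: differentiable_continuous; apply/derivable1_diffP.
  split.
  + by move=> a _.
  + by apply: cvg_at_right_filter; exact: cF.
  + by apply: cvg_at_left_filter; exact: cF.
- by move=> a _; rewrite derive1E derive_val.
Qed.

End overshoot_kernel.

Section tail_comparison.
Context {d : measure_display} {T : measurableType d} {R : realType}.
Variable P : probability T R.
Local Open Scope ereal_scope.

(** By the layer-cake formula a tail determines moments. *)
Lemma eq_tail_integral (X Y : T -> R) :
  measurable_fun setT X -> measurable_fun setT Y ->
  (forall w, (0 <= X w)%R) -> (forall w, (0 <= Y w)%R) ->
  (forall a, (0 <= a)%R -> P [set w | (a < X w)%R] = P [set w | (a < Y w)%R]) ->
  \int[P]_w (X w)%:E = \int[P]_w (Y w)%:E /\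
  \int[P]_w (X w ^+ 2)%:E = \int[P]_w (Y w ^+ 2)%:E.
Proof.
move=> mX mY X0 Y0 XY; split.
  rewrite !ge0_integral_tail//; apply: eq_integral => a.
  by rewrite inE/= in_itv/= andbT; exact: XY.
rewrite !ge0_integral_tail//.
- apply: eq_integral => a; rewrite inE/= in_itv/= andbT => a0.
  have sqE (Z : T -> R) : (forall w, (0 <= Z w)%R) ->
      [set w | (a < Z w ^+ 2)%R] = [set w | (Num.sqrt a < Z w)%R].
    move=> Z0; apply: eq_set => w; apply: propext.
    by rewrite -[in X in X <-> _](sqr_sqrtr a0) ltr_pXn2r ?nnegrE ?sqrtr_ge0.
  by rewrite !sqE// XY ?sqrtr_ge0.
- exact: measurable_funX.
- by move=> w; exact: sqr_ge0.
- exact: measurable_funX.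
- by move=> w; exact: sqr_ge0.
Qed.

End tail_comparison.

Section stable_inverse_moments.
Context {d : measure_display} {T : measurableType d} {R : realType}.
Variables (P : probability T R) (beta : R) (D : R -> {RV P >-> R}).
Hypothesis beta01 : 0 < beta < 1.
Hypothesis D_stable : stable_subordinator beta D.

Let subD : subordinator D := stable_sub D_stable.
Let levyD : levy_process D := subordinator_levy subD.
Local Notation E := (inverse_process D).
Let escD := stable_escapes D_stable.

Local Open Scope ereal_scope.

Let mE t : measurable_fun setT (E t).
Proof. exact: measurable_inverse_process. Qed.

Let E0 t w : (0 <= E t w)%R.
Proof. exact: inverse_process_ge0. Qed.

Local Notation h1 t := (\int[P]_w (E t w)%:E).
Local Notation h2 t := (\int[P]_w (E t w ^+ 2)%:E).

Lemma inverse_homo_ae (u v : R) : (u <= v)%R -> {ae P, forall w, (E u w <= E v w)%R}.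
Proof. by move=> uv; apply: filterS (escD v) => w ne; exact: le_inverse_process2. Qed.

Lemma inverse_moments_scaling (c t : R) : (0 < c)%R -> (0 < t)%R ->
  h1 (c * t) = (c `^ beta)%:E * h1 t /\
  h2 (c * t) = ((c `^ beta) ^+ 2)%:E * h2 t.
Proof.
move=> c0 t0; have cb : (0 < c `^ beta)%R by rewrite powR_gt0.
have mcE : measurable_fun setT (fun w => c `^ beta * E t w)%R.
  exact: measurable_funM.
have cE0 w : (0 <= c `^ beta * E t w)%R by rewrite mulr_ge0// ltW.
have [|e1 e2] := @eq_tail_integral _ _ _ P _ _ (mE (c * t)) mcE (E0 _) cE0.
  move=> a a0.
  have -> : a = (c `^ beta * (a / c `^ beta))%R by rewrite mulrC divfK// gt_eqF.
  rewrite (inverse_tail_scaling D_stable)// ?divr_ge0// ?(ltW cb)//.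
  congr (P _); apply: eq_set => w; apply: propext.
  by rewrite ltr_pM2l.
split; rewrite ?e1 ?e2.
  by rewrite ge0_integralM_EFin// ltW.
under eq_integral do rewrite exprMn.
rewrite ge0_integralM_EFin ?sqr_ge0//; first exact: measurable_funX.
by move=> w; exact: sqr_ge0.
Qed.

Let mccdf t : measurable_fun setT (fun r : R => P [set w | (r < E t w)%R]).
Proof.
pose X : {mfun T >-> R} := mfun_Sub (mem_set (@mE t) : E t \in mfun).
rewrite [X in measurable_fun _ X](_ : _ = ccdf (P := P) X).
  exact: ccdf_measurable.
apply/funext => r; rewrite /ccdf /distribution /pushforward; congr (P _).
by apply/seteqP; split => w /=; rewrite in_itv/= andbT.
Qed.

(** The tail of E_t at r is at most exp(t - r), and the exponential density
integrates to 1. *)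
Lemma inverse_mean_fin (t : R) : (0 <= t)%R -> h1 t < +oo.
Proof.
move=> t0; rewrite ge0_integral_tail//.
have pdf0 r := @exponential_pdf_ge0 R 1 ler01 r.
have mpdf : measurable_fun setT (fun r => (exponential_pdf (1 : R) r)%:E).
  by apply/measurable_EFinP; exact: measurable_exponential_pdf.
apply: (@le_lt_trans _ _ (\int[lebesgue_measure]_(r in `[0%R, +oo[)
    ((expR t)%:E * (exponential_pdf 1 r)%:E))).
  apply: ge0_le_integral => //.
  - exact: measurable_funTS (@mccdf t).
  - by apply: measurable_funTS; exact: measurable_funeM.
  - move=> r /=; rewrite in_itv/= andbT => r0.
    rewrite -EFinM exponential_pdfE// mul1r mulN1r -expRD.
    move: r0; rewrite le_eqVlt => /predU1P[<-|r0].
      apply: le_trans (probability_le1 P _) _; first exact: measurable_set_gt.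
      by rewrite lee_fin oppr0 addr0 -[leLHS]expR0 ler_expR.
    apply: le_trans (inverse_tail_le D_stable _ r0) _.
    exact: (stable_small_ball D_stable _ (ltW r0)).
rewrite ge0_integralZl_EFin ?expR_ge0//; last 2 first.
- by move=> r _; rewrite lee_fin.
- exact: measurable_funTS.
apply: (@le_lt_trans _ _ ((expR t)%:E * 1)); last by rewrite mule1 ltry.
apply: lee_wpmul2l; first by rewrite lee_fin expR_ge0.
rewrite -(@integral_exponential_pdf R 1)//.
by apply: ge0_subset_integral => // r _; rewrite lee_fin.
Qed.

(** In terms of D the joint event is D_a <= u and D_(a+b) <= v, up to shifts that
vanish in the limit. When D_a <= u, the second condition follows from
D_(a+b) - D_a <= v - u and implies D_(a+b) - D_a <= v, as D_a >= 0. These two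
conditions on the increment after time a are independent of D_a. *)
Lemma inverse_joint_tail_bounds (u v a b : R) :
  (0 <= u)%R -> (u <= v)%R -> (0 <= a)%R -> (0 <= b)%R ->
  P [set w | (a < E u w)%R] * P [set w | (b < E (v - u) w)%R] <=
    P [set w | (a < E u w)%R /\ (a + b < E v w)%R] /\
  P [set w | (a < E u w)%R /\ (a + b < E v w)%R] <=
    P [set w | (a < E u w)%R] * P [set w | (b < E v w)%R].
Proof.
move=> u0 uv a0 b0.
have ab0 : (0 <= a + b)%R by rewrite addr_ge0.
have J := @inverse_process_joint_tail _ _ _ P D subD escD 2 u v a (a + b)%R isT a0 ab0.
have fin (t r : R) : P [set w | (r < E t w)%R] \is a fin_num.
  by apply: fin_num_measure; exact: measurable_set_gt.
have tailM (t : R) :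
    (P [set w | (D (a + n.+1%:R^-1)%R w <= u)%R] *
     P [set w | (D (b + n.+1%:R^-1)%R w <= t)%R]) @[n --> \oo] -->
    P [set w | (a < E u w)%R] * P [set w | (b < E t w)%R].
  apply: cvgeM; first exact: mule_def_fin.
  - exact: inverse_process_tail.
  - exact: inverse_process_tail.
have inc (s h x y : R) : (0 <= s)%R -> (0 <= h)%R ->
    P ([set w | (D s w <= x)%R] `&` [set w | (D (s + h) w - D s w <= y)%R]) =
    P [set w | (D s w <= x)%R] * P [set w | (D h w <= y)%R].
  move=> s0 h0.
  have le_itv (X : T -> R) z : [set w | (X w <= z)%R] = X @^-1` `]-oo, z].
    by apply/seteqP; split => w /=; rewrite in_itv.
  rewrite !le_itv -(levy_increment_law levyD s0 h0) //.
  by apply: (levy_increment_independent levyD) => //; rewrite lerDl.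
have mle (X : T -> R) z : measurable_fun setT X -> measurable [set w | (X w <= z)%R].
  exact: measurable_set_le.
have shift n : (a + b + 2 * n.+1%:R^-1 = a + n.+1%:R^-1 + (b + n.+1%:R^-1) :> R)%R.
  by ring.
have pos n x : (0 <= x -> 0 <= x + n.+1%:R^-1 :> R)%R by move=> ?; rewrite addr_ge0.
have mD s h : measurable_fun setT (fun w => D (s + h)%R w - D s w)%R.
  exact: measurable_funB.
split.
  rewrite -(cvg_lim _ (tailM (v - u)%R))// -(cvg_lim _ J)//.
  apply: lee_lim; [by apply/cvg_ex; eexists; exact: tailM
                  |by apply/cvg_ex; eexists; exact: J|].
  apply: nearW => n; rewrite -inc ?pos//; apply: le_measure; rewrite ?inE.
  - by apply: measurableI; exact: mle.
  - by apply: measurableI; exact: mle.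
  - by move=> w [/= h1' h2']; split => //; rewrite shift; lra.
rewrite -(cvg_lim _ (tailM v))// -(cvg_lim _ J)//.
apply: lee_lim; [by apply/cvg_ex; eexists; exact: J
                |by apply/cvg_ex; eexists; exact: tailM|].
apply: nearW => n; rewrite -inc ?pos//; apply: le_measure; rewrite ?inE.
- by apply: measurableI; exact: mle.
- by apply: measurableI; exact: mle.
- move=> w [/= h1' h2']; split => //=; rewrite shift in h2'.
  by have := subordinator_ge0 subD w (pos n _ a0); lra.
Qed.

Local Notation J u v := (\int[P]_w \int[lebesgue_measure]_a
  (overshoot_kernel (E u w) (E v w) a)%:E).

(** The tail of E_u, extended by 0 to negative a. *)
Let f (u a : R) := if (0 <= a)%R then P [set w | (a < E u w)%R] else 0.

Let mf u : measurable_fun setT (f u).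
Proof. by apply: measurable_fun_ifT => //; exact: measurable_fun_ler. Qed.

Let f_ge0 u a : 0 <= f u a.
Proof. by rewrite /f; case: ifP. Qed.

Let integral_f u : \int[lebesgue_measure]_a f u a = h1 u.
Proof.
rewrite ge0_integral_tail// [RHS]integral_mkcond; apply: eq_integral => a _.
by rewrite patchE mem_setE in_itv/= andbT.
Qed.

(** The bounds on joint tails, integrated over b. *)
Let kernel_mean_bounds (u v a : R) : (0 <= u)%R -> (u <= v)%R ->
  f u a * h1 (v - u) <= \int[P]_w (overshoot_kernel (E u w) (E v w) a)%:E /\
  \int[P]_w (overshoot_kernel (E u w) (E v w) a)%:E <= f u a * h1 v.
Proof.
move=> u0 uv.
have k0 w := overshoot_kernel_ge0 (E u w) (E v w) a.
have mk : measurable_fun setT (fun w => overshoot_kernel (E u w) (E v w) a).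
  exact: measurable_overshoot_kernel.
have [a0|a0] := leP 0%R a; last first.
  have a0F : (0 <= a)%R = false by rewrite leNgt a0.
  rewrite /f a0F !mul0e.
  have -> : \int[P]_w (overshoot_kernel (E u w) (E v w) a)%:E = 0.
    by apply: integral0_eq => w _; rewrite /overshoot_kernel a0F.
  by [].
have fa : f u a = P [set w | (a < E u w)%R].
  by rewrite /f a0.
have kE b : (0 <= b)%R -> [set w | (b < overshoot_kernel (E u w) (E v w) a)%R] =
    [set w | (a < E u w)%R /\ (a + b < E v w)%R].
  move=> b0; apply: eq_set => w; apply: propext.
  rewrite /overshoot_kernel a0/=; case: ifPn => aE.
    rewrite lt_max [X in _ || X]ltNge b0/= orbF ltrBrDl; split => // -[//].
  by rewrite ltNge b0; split => // -[].
rewrite ge0_integral_tail// fa !ge0_integral_tail//.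
rewrite -!ge0_integralZl//; last 2 first.
- exact: measurable_funTS (@mccdf _).
- exact: measurable_funTS (@mccdf _).
pose X : {mfun T >-> R} := mfun_Sub (mem_set mk : _ \in mfun).
have mX : measurable_fun setT
   (fun b : R => P [set w | (b < overshoot_kernel (E u w) (E v w) a)%R]).
  rewrite [X in measurable_fun _ X](_ : _ = ccdf (P := P) X).
    exact: ccdf_measurable.
  apply/funext => r; rewrite /ccdf /distribution /pushforward; congr (P _).
  by apply/seteqP; split => w /=; rewrite in_itv/= andbT.
split; apply: ge0_le_integral => //.
- by move=> b _; exact: mule_ge0.
- by apply: measurable_funTS; apply: measurable_funeM; exact: mccdf.
- exact: measurable_funTS.
- move=> b /=; rewrite in_itv/= andbT => b0; rewrite kE//.
  by have [] := inverse_joint_tail_bounds u0 uv a0 b0.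
- exact: measurable_funTS.
- by apply: measurable_funTS; apply: measurable_funeM; exact: mccdf.
- move=> b /=; rewrite in_itv/= andbT => b0; rewrite kE//.
  by have [] := inverse_joint_tail_bounds u0 uv a0 b0.
Qed.

(** The bounds on joint tails, integrated over a and b. *)
Lemma inverse_overshoot_bounds (u v : R) : (0 <= u)%R -> (u <= v)%R ->
  h1 u * h1 (v - u) <= J u v /\ J u v <= h1 u * h1 v.
Proof.
move=> u0 uv.
have h0 t : 0 <= h1 t by apply: integral_ge0 => w _; rewrite lee_fin.
have mk : measurable_fun setT
    (fun z : T * R => (overshoot_kernel (E u z.1) (E v z.1) z.2)%:E).
  apply/measurable_EFinP; apply: measurable_overshoot_kernel => //.
  - exact: measurableT_comp (mE u) measurable_fst.
  - exact: measurableT_comp (mE v) measurable_fst.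
have k0 (z : T * R) : 0 <= (overshoot_kernel (E u z.1) (E v z.1) z.2)%:E.
  by rewrite lee_fin overshoot_kernel_ge0.
have JE : J u v = \int[lebesgue_measure]_a \int[P]_w
    (overshoot_kernel (E u w) (E v w) a)%:E.
  exact: (fubini_tonelli (m1 := P) (m2 := lebesgue_measure) _ mk k0).
have mG : measurable_fun setT (fun a : R => \int[P]_w
    (overshoot_kernel (E u w) (E v w) a)%:E).
  exact: (measurable_fun_fubini_tonelli_G (m1 := P) _ mk k0).
rewrite JE -(integral_f u) -!ge0_integralZr//; last 2 first.
- exact: (@mf u).
- exact: (@mf u).
split; apply: ge0_le_integral => //.
- by move=> a _; exact: mule_ge0.
- exact: emeasurable_funM (@mf u) (measurable_cst _).
- by move=> a _; have [] := @kernel_mean_bounds u v a u0 uv.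
- by move=> a _; apply: integral_ge0 => w _; rewrite lee_fin overshoot_kernel_ge0.
- exact: emeasurable_funM (@mf u) (measurable_cst _).
- by move=> a _; have [] := @kernel_mean_bounds u v a u0 uv.
Qed.

End stable_inverse_moments.

(** * Powers with exponent in ]0, 1[ *)

Section powR_concavity.
Context {R : realType}.
Implicit Types (b x y : R).

(** Concavity: beyond K the slope of x^b is at most K^(b-1). *)
Lemma powR_sub_le_lin b K x y : 0 < b < 1 -> 0 < K -> K <= x -> 0 <= y ->
  (x + y) `^ b <= x `^ b + y * (K `^ b / K).
Proof.
move=> /andP[b0 b1] K0 Kx y0.
have x0 : 0 < x by exact: lt_le_trans Kx.
have -> : x + y = x * (1 + y / x) by rewrite mulrDr mulr1 mulrC divfK// gt_eqF.
have yx0 : 0 <= y / x by rewrite divr_ge0// ltW.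
rewrite powRM ?addr_ge0 ?(ltW x0)//.
have h1 : (1 + y / x) `^ b <= 1 + y / x.
  by rewrite ler1_powR ?lerDl// ltW.
apply: (@le_trans _ _ (x `^ b * (1 + y / x))).
  by rewrite ler_wpM2l// powR_ge0.
rewrite mulrDr mulr1 lerD2l mulrCA ler_wpM2l//.
have pE z : 0 < z -> z `^ b / z = (z `^ (1 - b))^-1.
  move=> z0; rewrite -powRN opprB powRB ?powRr1 ?(ltW z0)//.
  by rewrite (gt_eqF z0) implybT.
rewrite !pE// lef_pV2 ?posrE ?powR_gt0//.
by apply: ge0_ler_powR => //; rewrite ?nnegrE ?subr_ge0 ?ltW.
Qed.

(** With s = x + y, concavity gives z/s <= (z/s)^b for z = x and z = y, and these
two ratios add up to 1. *)
Lemma powR_add_le b x y : 0 < b < 1 -> 0 <= x -> 0 <= y ->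
  (x + y) `^ b <= x `^ b + y `^ b.
Proof.
move=> /andP[b0 b1] x0 y0.
have [xy0|xyN0] := eqVneq (x + y) 0.
  rewrite xy0 powR0 ?gt_eqF// addr_ge0// powR_ge0//.
have s0 : 0 < x + y by rewrite lt_neqAle eq_sym xyN0 addr_ge0.
have bound z : 0 <= z -> z <= x + y -> z / (x + y) * (x + y) `^ b <= z `^ b.
  rewrite le_eqVlt => /predU1P[<- _|z0 zs].
    by rewrite mul0r mul0r powR_ge0.
  rewrite -[in leRHS](divfK (lt0r_neq0 s0) z) powRM ?divr_ge0 ?(ltW z0) ?(ltW s0)//.
  rewrite ler_wpM2r ?powR_ge0// ger1_powR ?(ltW b1)//.
  by rewrite divr_gt0//= ler_pdivrMr// mul1r.
apply: le_trans (lerD (bound x x0 _) (bound y y0 _)); rewrite ?lerDl ?lerDr//.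
by rewrite -mulrDl -mulrDl divff// mul1r.
Qed.

Lemma powR_sub1_le b x : 0 < b < 1 -> 0 <= x -> `|x `^ b - 1| <= `|x - 1|.
Proof.
move=> /andP[b0 b1] x0; have [x1|x1] := leP 1 x.
  have h : 1 <= x `^ b by rewrite -(powRr0 x) ler_powR// ltW.
  by rewrite !ger0_norm ?subr_ge0// lerD2r ler1_powR// ltW.
have h : x `^ b <= 1.
  rewrite -[leRHS](congr1 (@^~ b) (@powR1 R)).
  by apply: ge0_ler_powR; rewrite ?nnegrE ?(ltW b0) ?(ltW x1).
have h2 : x <= x `^ b.
  move: x0; rewrite le_eqVlt => /predU1P[<-|x0]; first exact: powR_ge0.
  by rewrite ger1_powR ?x0 ?ltW.
by rewrite !ler0_norm ?subr_le0 ?(ltW x1)// lerN2 lerD2r.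
Qed.

Lemma powR_div_small b (e : R) : 0 < b < 1 -> 0 < e ->
  exists2 K0 : R, 0 < K0 & forall K, K0 <= K -> K `^ b / K <= e.
Proof.
move=> /andP[b0 b1] e0; have b1' : 0 < 1 - b by rewrite subr_gt0.
exists (e^-1 `^ (1 - b)^-1); first by rewrite powR_gt0// invr_gt0.
move=> K; set K0 := _ `^ _ => K0K.
have K00 : 0 < K0 by rewrite powR_gt0// invr_gt0.
have Kp : 0 < K by exact: lt_le_trans K0K.
have -> : K `^ b / K = (K `^ (1 - b))^-1.
  rewrite -powRN opprB powRB ?powRr1 ?(ltW Kp)//.
  by rewrite (gt_eqF Kp) implybT.
rewrite -[leRHS]invrK lef_pV2 ?posrE ?powR_gt0 ?invr_gt0//.
have -> : e^-1 = K0 `^ (1 - b).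
  by rewrite /K0 -powRrM mulVf ?gt_eqF// powRr1// invr_ge0 ltW.
by apply: ge0_ler_powR; rewrite ?nnegrE ?(ltW b1') ?(ltW K00) ?(ltW Kp).
Qed.

End powR_concavity.

(** * Second-order structure of the inverse stable subordinator *)

Section stable_inverse_second_order.
Context {d : measure_display} {T : measurableType d} {R : realType}.
Variables (P : probability T R) (beta : R) (D : R -> {RV P >-> R}).
Hypothesis beta01 : 0 < beta < 1.
Hypothesis D_stable : stable_subordinator beta D.

Let subD : subordinator D := stable_sub D_stable.
Let E : R -> T -> R := inverse_process D.

Local Open Scope ereal_scope.

Let mE t : measurable_fun setT (E t).
Proof. exact: measurable_inverse_process. Qed.

Let E0 t w : (0 <= E t w)%R.
Proof. exact: inverse_process_ge0. Qed.

Let h1 t := \int[P]_w (E t w)%:E.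
Let h2 t := \int[P]_w (E t w ^+ 2)%:E.
Let k u v := \int[P]_w (E u w * E v w)%:E.
Let J u v := \int[P]_w \int[lebesgue_measure]_a
  (overshoot_kernel (E u w) (E v w) a)%:E.

(** The value of the integrated overshoot kernel where E_u <= E_v. This holds
only almost surely, and the maximum with 0 keeps g nonnegative elsewhere. *)
Let g u v w := Num.max (E u w * E v w - E u w ^+ 2 / 2)%R 0%R.

Let g0 u v w : (0 <= g u v w)%R.
Proof. by rewrite /g le_max lexx orbT. Qed.

Let mg u v : measurable_fun setT (g u v).
Proof.
apply: measurable_maxr => //; apply: measurable_funB; first exact: measurable_funM.
by apply: measurable_funM => //; exact: measurable_funX.
Qed.

Let gE u v w : (E u w <= E v w)%R -> g u v w = (E u w * E v w - E u w ^+ 2 / 2)%R.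
Proof.
by move=> uvw; rewrite /g max_l// subr_ge0; have := E0 u w; nra.
Qed.

Let JE (u v : R) : (u <= v)%R -> J u v = \int[P]_w (g u v w)%:E.
Proof.
move=> uv; apply: ge0_ae_eq_integral => //.
- have mk : measurable_fun setT
      (fun z : T * R => (overshoot_kernel (E u z.1) (E v z.1) z.2)%:E).
    apply/measurable_EFinP; apply: measurable_overshoot_kernel => //.
    + exact: measurableT_comp (mE u) measurable_fst.
    + exact: measurableT_comp (mE v) measurable_fst.
  have k0 (z : T * R) : 0 <= (overshoot_kernel (E u z.1) (E v z.1) z.2)%:E.
    by rewrite lee_fin overshoot_kernel_ge0.
  exact: (measurable_fun_fubini_tonelli_F (m2 := lebesgue_measure) _ mk k0).
- exact/measurable_EFinP.
- by move=> w _; apply: integral_ge0 => a _; rewrite lee_fin overshoot_kernel_ge0.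
- by move=> w _; rewrite lee_fin.
- apply: filterS (inverse_homo_ae D_stable uv) => w uvw _.
  by rewrite integral_overshoot_kernel// gE.
Qed.

Let m2 u : measurable_fun setT (fun w => E u w ^+ 2)%R.
Proof. exact: measurable_funX. Qed.

Let JJ u : J u u = (2^-1)%:E * h2 u.
Proof.
rewrite JE// -ge0_integralM_EFin//; last by move=> w; exact: sqr_ge0.
by apply: eq_integral => w _; rewrite gE//; congr _%:E; field.
Qed.

Let kE (u v : R) : (u <= v)%R -> k u v = J u v + (2^-1)%:E * h2 u.
Proof.
move=> uv; rewrite JE// -ge0_integralM_EFin//; last by move=> w; exact: sqr_ge0.
rewrite -ge0_integralD_EFin//; last 2 first.
- exact: measurable_funM.
- by move=> w; rewrite mulr_ge0 ?sqr_ge0.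
apply: ae_eq_integral_EFin => //.
- exact: measurable_funM.
- by apply: measurable_funD => //; exact: measurable_funM.
- by move=> w; rewrite mulr_ge0.
- by move=> w; rewrite addr_ge0// mulr_ge0 ?sqr_ge0.
- apply: filterS (inverse_homo_ae D_stable uv) => w uvw.
  by rewrite gE//; field.
Qed.

Let h1_ge0 t : 0 <= h1 t.
Proof. by apply: integral_ge0 => w _; rewrite lee_fin. Qed.

Let h2_ge0 t : 0 <= h2 t.
Proof. by apply: integral_ge0 => w _; rewrite lee_fin sqr_ge0. Qed.

Let h1_fin t : (0 <= t)%R -> h1 t \is a fin_num.
Proof. by move=> t0; rewrite ge0_fin_numE// (inverse_mean_fin D_stable). Qed.

(** The case u = v of [inverse_overshoot_bounds]; it makes the second moment
finite as soon as the first one is. *)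
Let h2_le t : (0 <= t)%R -> (2^-1)%:E * h2 t <= h1 t * h1 t.
Proof.
by move=> t0; rewrite -JJ; have [] := inverse_overshoot_bounds D_stable t0 (lexx t).
Qed.

Let h2_fin t : (0 <= t)%R -> h2 t \is a fin_num.
Proof.
move=> t0; rewrite ge0_fin_numE// ltNge; apply/negP => h2y.
have := h2_le t0; move: h2y; rewrite leye_eq => /eqP ->.
rewrite gt0_muley ?lte_fin ?invr_gt0// leye_eq => /eqP h.
by have := fin_numM (h1_fin t0) (h1_fin t0); rewrite h.
Qed.

Let C1 := fine (h1 1).
Let C2 := fine (h2 1).

Let pbeta : (0 < beta)%R. Proof. by have /andP[] := beta01. Qed.

(** Self-similarity compares t with 1 if t > 0. At t = 0 the mean is at most
that at every u > 0, hence 0. *)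
Let h1E t : (0 <= t)%R -> h1 t = (C1 * t `^ beta)%:E.
Proof.
have C10 : (0 <= C1)%R by rewrite fine_ge0.
have pos u : (0 < u)%R -> h1 u = (C1 * u `^ beta)%:E.
  move=> u0; have -> : h1 u = (u `^ beta)%:E * h1 1.
    by have [+ _] := inverse_moments_scaling D_stable u0 ltr01; rewrite mulr1.
  by rewrite -(fineK (h1_fin ler01)) -EFinM mulrC.
rewrite le_eqVlt => /predU1P[<-|/pos//].
rewrite powR0 ?gt_eqF// mulr0; apply/eqP; rewrite eq_le h1_ge0 andbT.
rewrite -(fineK (h1_fin (lexx 0%R))) lee_fin leNgt; apply/negP => r0.
set r := fine _ in r0.
have rd : (0 < r / (C1 + 1))%R by rewrite divr_gt0// ltr_wpDl.
pose u := ((r / (C1 + 1)) `^ beta^-1)%R.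
have u0 : (0 < u)%R by rewrite powR_gt0.
have : (r <= C1 * u `^ beta)%R.
  rewrite -lee_fin -pos// /r fineK ?h1_fin//.
  apply: ae_le_integral_EFin => //; exact: (inverse_homo_ae D_stable (ltW u0)).
rewrite /u -powRrM mulVf ?gt_eqF// powRr1 ?(ltW rd)// mulrCA leNgt.
by rewrite gtr_pMr// ltr_pdivrMr ?ltr_wpDl// mul1r ltrDl ltr01.
Qed.

Let h2E t : (0 <= t)%R -> h2 t = (C2 * (t `^ beta) ^+ 2)%:E.
Proof.
rewrite le_eqVlt => /predU1P[<-|u0].
  rewrite powR0 ?gt_eqF// expr0n/= mulr0; apply/eqP; rewrite eq_le h2_ge0 andbT.
  have := h2_le (lexx 0%R); rewrite h1E// powR0 ?gt_eqF// mulr0 mul0e.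
  by rewrite pmule_rle0// lte_fin invr_gt0.
have -> : h2 t = ((t `^ beta) ^+ 2)%:E * h2 1.
  by have [_ +] := inverse_moments_scaling D_stable u0 ltr01; rewrite mulr1.
by rewrite -(fineK (h2_fin ler01)) -EFinM mulrC.
Qed.

Let k_bounds u v : (0 <= u)%R -> (u <= v)%R ->
  (C2 / 2 * (u `^ beta) ^+ 2 + C1 ^+ 2 * (u `^ beta * (v - u) `^ beta))%:E <= k u v /\
  k u v <= (C2 / 2 * (u `^ beta) ^+ 2 + C1 ^+ 2 * (u `^ beta * v `^ beta))%:E.
Proof.
move=> u0 uv; have v0 := le_trans u0 uv.
have [b1 b2] := inverse_overshoot_bounds D_stable u0 uv.
rewrite kE// h2E// -EFinM; split.
  rewrite EFinD addeC; apply: leeD; last by rewrite lee_fin; lra.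
  apply: le_trans b1; rewrite -/(h1 u) -/(h1 (v - u)) !h1E ?subr_ge0// -EFinM.
  by rewrite lee_fin; nra.
rewrite EFinD addeC; apply: leeD; first by rewrite lee_fin; lra.
apply: le_trans b2 _; rewrite -/(h1 u) -/(h1 v) !h1E// -EFinM.
by rewrite lee_fin; nra.
Qed.

Let mean_E t : (0 <= t)%R -> has_mean P (E t) (C1 * t `^ beta)%R.
Proof. by move=> t0; split => //; exact: h1E. Qed.

Let mean_E2 t : (0 <= t)%R ->
  has_mean P (fun w => E t w ^+ 2)%R (C2 * (t `^ beta) ^+ 2)%R.
Proof. by move=> t0; split; [exact: m2|move=> w; exact: sqr_ge0|exact: h2E]. Qed.

(** E_1 > 1/4 has a probability at least that of D_(1/2) <= 1, which is positive
since exp(- 1/2), the Laplace transform of D_(1/2) at 1, exceeds exp(- 1). *)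
Let C1_gt0 : (0 < C1)%R.
Proof.
have mle : measurable [set w | (D 2^-1%R w <= 1)%R].
  exact: measurable_subordinator_le.
have mexp : measurable_fun setT (fun w => expR (- D 2^-1%R w)).
  by apply: measurableT_comp => //; exact: measurableT_comp.
have laplace : \int[P]_w (expR (- D 2^-1%R w))%:E = (expR (- 2^-1))%:E.
  have half0 : (0 <= 2^-1 :> R)%R by rewrite invr_ge0.
  have := stable_laplace D_stable ltr01 half0; rewrite powR1 mulr1 unlock => <-.
  by apply: eq_integral => w _; rewrite mul1r.
have small : (expR (- 2^-1))%:E <= P [set w | (D 2^-1%R w <= 1)%R] + (expR (- 1))%:E.
  rewrite -laplace -(@integral_cst_probability _ _ _ P (expR (-1))%:E).
  rewrite -[X in P X]setIT -integral_indic// -ge0_integralD_EFin//.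
  apply: ge0_le_integral_EFin => //.
  - exact: measurable_funD (measurable_indic mle) (measurable_cst _).
  - move=> w; rewrite indicE; have [_|] := boolP (w \in _).
      apply: (@le_trans _ _ 1%R); last by rewrite lerDl expR_ge0.
      by rewrite -[leRHS]expR0 ler_expR oppr_le0 subordinator_ge0.
    rewrite notin_setE/= => /negP; rewrite -ltNge => D1.
    by rewrite add0r ler_expR lerN2 ltW.
have tail : P [set w | (D 2^-1%R w <= 1)%R] <= P [set w | (4^-1 < E 1 w)%R].
  by apply: (inverse_tail_ge D_stable) => //; lra.
have markov : (4^-1)%:E * P [set w | (4^-1 < E 1 w)%R] <= h1 1.
  have mA : measurable [set w | (4^-1 < E 1 w)%R] by exact: measurable_set_gt.
  rewrite -[X in P X]setIT -integral_indic// -ge0_integralM_EFin//.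
  apply: ge0_le_integral_EFin => //.
  - exact: measurable_funM.
  - move=> w; rewrite indicE; have [/set_mem/ltW/=|_] := boolP (w \in _).
      by rewrite mulr1.
    by rewrite mulr0.
rewrite ltNge; apply/negP => C10.
have p0 : P [set w | (4^-1 < E 1 w)%R] <= 0.
  rewrite -(@pmule_rle0 _ (4^-1)%:E) ?lte_fin ?invr_gt0//.
  apply: le_trans markov _.
  by rewrite -(fineK (h1_fin ler01)) lee_fin.
have := le_trans small (leeD (le_trans tail p0) (lexx _)).
by rewrite add0e lee_fin ler_expR lerN2 leNgt invf_lt1 ?ltr1n.
Qed.

(** In case of equality E_1 would be the constant C1, and E[E_1 E_v] would be
C1^2 v^beta. The lower bound on E[E_1 E_v] is C1^2 / 2 + C1^2 (v - 1)^beta, and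
v^beta - (v - 1)^beta < 1/2 for large v. *)
Let C12 : (C1 ^+ 2 < C2)%R.
Proof.
have [_ E1_0 e1] := mean_E ler01; have [_ _ e2] := mean_E2 ler01.
rewrite powR1 mulr1 in e1; rewrite powR1 expr1n mulr1 in e2.
rewrite lt_neqAle (le_integral_sqr (mE 1) E1_0 e1 e2) andbT.
apply/eqP => C12.
have [K K0 KP] := powR_div_small beta01 (divr_gt0 ltr01 (ltr0n R 8)).
pose v := (K + 1)%R; have v0 : (0 <= v)%R by rewrite addr_ge0// ltW.
have v1 : (1 <= v)%R by rewrite lerDr ltW.
pose V := (v `^ beta)%R; have V0 : (0 < V)%R by rewrite powR_gt0// ltr_wpDl// ltW.
have VK : (V <= K `^ beta + 8^-1)%R.
  apply: le_trans (powR_sub_le_lin beta01 K0 (lexx K) ler01) _.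
  by rewrite mul1r lerD2l (le_trans (KP K (lexx K)))// div1r.
have [lo hi] := k_bounds ler01 v1.
rewrite /v addrK powR1 expr1n mulr1 mul1r -/v in lo.
have kmean : has_mean P (fun w => E 1 w * E v w)%R (fine (k 1 v)).
  split; [exact: measurable_funM|by move=> w; rewrite mulr_ge0|].
  rewrite fineK// ge0_fin_numE; first by rewrite (le_lt_trans hi)// ltry.
  by apply: integral_ge0 => w _; rewrite lee_fin mulr_ge0.
have [_ _ kf] := kmean; rewrite /k kf lee_fin in lo.
(* E_1 = C1 is used through E[(E_1 - C1)^2] = 0 and Young's inequality for
   (E_1 - C1) E_v with weight dl; this value of dl leaves an error C2 / 8 *)
pose dl := (4 * V ^+ 2)%R.
have dl0 : (0 < dl)%R by rewrite /dl mulr_gt0// exprn_gt0.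
have m1 := has_meanD kmean (has_meanZ (mulr_ge0 (ltW dl0) (ltW C1_gt0)) (mean_E ler01)).
have m3 := has_meanD (has_meanZ (ltW C1_gt0) (mean_E v0))
  (has_meanD (has_meanZ (divr_ge0 (ltW dl0) (ler0n R 2))
     (has_meanD (mean_E2 ler01) (has_mean_cst P (sqr_ge0 C1))))
   (has_meanZ (divr_ge0 ler01 (mulr_ge0 (ler0n R 2) (ltW dl0))) (mean_E2 v0))).
have := has_mean_le m1 m3 _; rewrite powR1 expr1n !mulr1 -/V.
move=> /(_ _)/wrap[].
  move=> w /=; rewrite -subr_ge0.
  have -> : (C1 * E v w + (dl / 2 * (E 1 w ^+ 2 + C1 ^+ 2) +
      1 / (2 * dl) * E v w ^+ 2) - (E 1 w * E v w + dl * C1 * E 1 w) =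
      (dl * (E 1 w - C1) - E v w) ^+ 2 / (2 * dl))%R.
    by field; rewrite gt_eqF.
  by rewrite divr_ge0 ?sqr_ge0// mulr_ge0// ltW.
have -> : (1 / (2 * dl) * (C2 * V ^+ 2) = C2 / 8)%R.
  by rewrite /dl; field; rewrite gt_eqF.
move: VK lo; rewrite -C12; have := exprn_gt0 2 C1_gt0; nra.
Qed.

Lemma stable_inverse_second_order : exists C1 C2 : R,
  [/\ (0 < C1)%R, (C1 ^+ 2 < C2)%R,
   forall t, (0 <= t)%R -> \int[P]_w (E t w)%:E = (C1 * t `^ beta)%:E,
   forall t, (0 <= t)%R ->
     \int[P]_w (E t w ^+ 2)%:E = (C2 * (t `^ beta) ^+ 2)%:E &
   forall u v, (0 <= u)%R -> (u <= v)%R ->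
     (C2 / 2 * (u `^ beta) ^+ 2 +
       C1 ^+ 2 * (u `^ beta * (v - u) `^ beta))%:E
       <= \int[P]_w (E u w * E v w)%:E
       <= (C2 / 2 * (u `^ beta) ^+ 2 + C1 ^+ 2 * (u `^ beta * v `^ beta))%:E].
Proof.
exists C1, C2; split; [exact: C1_gt0|exact: C12|exact: h1E|exact: h2E|].
move=> u v u0 uv.
by have [b1 b2] := k_bounds u0 uv; apply/andP.
Qed.

End stable_inverse_second_order.

(** * Poisson variables and fractional Poisson paths *)

Section poisson_moments.
Context {d : measure_display} {T : measurableType d} {R : realType}.
Variables (P : probability T R) (r : R) (X : {RV P >-> R}).
Hypothesis r0 : 0 < r.
Hypothesis X_law : forall k : nat, P (X @^-1` [set k%:R]) = (poisson_pmf r k)%:E.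

Local Open Scope ereal_scope.

Lemma nneseries_poisson_pmf (s : R) : (0 < s)%R ->
  \sum_(k <oo) (poisson_pmf s k)%:E = 1.
Proof.
move=> s0; rewrite nneseries_esumT; last first.
  by move=> *; rewrite lee_fin poisson_pmf_ge0.
have h : poisson_prob s 0 setT = 1 := probability_setT _.
by rewrite /poisson_prob s0 in h.
Qed.

Let A (k : nat) : set T := X @^-1` [set k%:R].

Let mA k : measurable (A k). Proof. exact: measurable_preimage. Qed.

Let trivA : trivIset setT A.
Proof.
apply/trivIsetP => i j _ _ ij; rewrite -subset0 => w [].
by rewrite /A/= => -> /eqP; rewrite eqr_nat (negbTE ij).
Qed.

Let PA : P (\bigcup_k A k) = 1.
Proof.
rewrite measure_bigcup// -(nneseries_poisson_pmf r0).
rewrite (eq_eseriesl (Q := xpredT)); last by move=> k; rewrite in_setT.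
by apply: eq_eseriesr => k _; exact: X_law.
Qed.

(** The Poisson weights add up to 1, so X is almost surely a natural number. *)
Let PAC : P (~` \bigcup_k A k) = 0.
Proof.
rewrite probability_setC; last exact: bigcupT_measurable.
by rewrite PA subee.
Qed.

Lemma poisson_integral (f : R -> R) : measurable_fun setT f ->
  (forall x, (0 <= f x)%R) ->
  \int[P]_w (f (X w))%:E = \sum_(k <oo) (f k%:R * poisson_pmf r k)%:E.
Proof.
move=> mf f0.
have mfX : measurable_fun setT (fun w => (f (X w))%:E).
  exact/measurable_EFinP/measurableT_comp.
have mU : measurable (\bigcup_k A k) by exact: bigcupT_measurable.
rewrite (ge0_negligible_integral (measurableC mU))//; last first.
  by move=> w _; rewrite lee_fin.
rewrite setTD setCK ge0_integral_bigcup//; last 2 first.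
- exact: measurable_funTS.
- by move=> w _; rewrite lee_fin.
apply: eq_eseriesr => k _.
rewrite EFinM -X_law -integral_cst//.
by apply: eq_integral => w; rewrite inE/= => ->.
Qed.

Lemma poisson_ge0 : {ae P, forall w, (0 <= X w)%R}.
Proof.
exists (~` \bigcup_k A k); split.
- by apply: measurableC; exact: bigcupT_measurable.
- exact: PAC.
- apply: subsetC => w [k _]; rewrite /A/= => ->.
  exact: ler0n.
Qed.

(** Since k^2 <= 2 * 2^k, the series is dominated by a multiple of the total mass
of the Poisson law of rate 2 r. *)
Lemma poisson_sqr_lty : \int[P]_w (X w ^+ 2)%:E < +oo.
Proof.
rewrite (poisson_integral (f := fun x => x ^+ 2)%R)//; last first.
  by move=> x; exact: sqr_ge0.
have sq k : (k ^ 2 <= 2 * 2 ^ k)%N.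
  elim: k => // -[|[|[|k]]]// IH.
  by rewrite [in leqRHS]expnS; move: IH; set m := (2 ^ _)%N; nia.
have bound k : (k%:R ^+ 2 * poisson_pmf r k <= 2 * expR r * poisson_pmf (2 * r) k)%R.
  rewrite /poisson_pmf r0 mulr_gt0// exprMn.
  have -> : (2 * expR r * (2 ^+ k * r ^+ k / k`!%:R * expR (- (2 * r))) =
    2 * 2 ^+ k * (r ^+ k / k`!%:R * expR (- r)))%R.
    rewrite (_ : - (2 * r) = - r - r)%R; last by ring.
    rewrite expRD (expRN r); field.
    by rewrite gt_eqF ?expR_gt0// pnatr_eq0 -lt0n fact_gt0.
  rewrite ler_wpM2r ?mulr_ge0 ?expR_ge0 ?exprn_ge0 ?(ltW r0)//.
  by rewrite -!natrX -natrM ler_nat.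
apply: (@le_lt_trans _ _ (\sum_(k <oo) ((2 * expR r)%:E * (poisson_pmf (2 * r) k)%:E))).
  apply: lee_nneseries.
    by move=> k _ _; rewrite lee_fin mulr_ge0 ?sqr_ge0 ?poisson_pmf_ge0.
  by move=> k _; rewrite -EFinM lee_fin.
rewrite nneseriesZl; last by move=> k _; rewrite lee_fin poisson_pmf_ge0.
by rewrite nneseries_poisson_pmf ?mulr_gt0// mule1 ltry.
Qed.

Lemma poisson_mean_gt0 : 0 < \int[P]_w `|X w|%:E.
Proof.
have p1 : 0 < P (A 1%N).
  by rewrite X_law lte_fin /poisson_pmf r0 !mulr_gt0 ?expR_gt0.
apply: lt_le_trans p1 _.
rewrite -[X in P X]setIT -integral_indic//.
apply: ge0_le_integral_EFin => //.
- exact: measurableT_comp.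
- move=> w; rewrite indicE; have [/set_mem/= ->|_] := boolP (w \in _).
    by rewrite normr1.
  by rewrite normr_ge0.
Qed.

End poisson_moments.

Section fractional_poisson.
Context {d : measure_display} {T : measurableType d} {R : realType}.
Variables (P : probability T R) (D N : R -> {RV P >-> R}).
Hypothesis levyN : levy_process N.

(** The inverse process is right-continuous at t: if s is a passage time for t,
then it still is one for all u > t close to t, because D_s > t. It is moreover
nondecreasing, so right continuity of N applies. If there is no passage time
for t, then there is none for u > t, and both inverses are 0. *)
Lemma fpp_right_continuous (w : T) (t : R) : 0 <= t ->
  fpp D N u w @[u --> t^'+] --> fpp D N t w.
Proof.
move=> t0; pose x := inverse_process D t w.
have x0 : 0 <= x by exact: inverse_process_ge0.
have [rcN _] := levy_cadlag levyN w.
have {}rcN := rcN x x0.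
apply/cvgrPdist_lt => e e0; rewrite /fpp -/x.
pose passed u := [set s : R | 0 < s /\ u < D s w].
have [p0|/set0P p0] := eqVneq (passed t) set0.
  near=> u; rewrite /x {1}/inverse_process -/(passed t) p0.
  rewrite {1}/inverse_process -/(passed u) (_ : passed u = set0) ?subrr ?normr0//.
  rewrite -subset0 -p0 => s [s0 uD]; split => //; apply: lt_trans uD.
  by near: u; exact: nbhs_right_gt.
move/cvgrPdist_lt : rcN => /(_ _ e0).
rewrite /at_right near_withinE => /nbhs_ballP[dl dl0 Hdl].
have [s [s0 tD] sx] : exists2 s, passed t s & s < x + dl.
  by apply: inf_lt => //; rewrite -[X in X < _]addr0 ltrD2l.
near=> u.
have uD : u < D s w by near: u; exact: nbhs_right_lt.
have tu : t < u by near: u; exact: nbhs_right_gt.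
have pu : passed u !=set0 by exists s.
have xu : x <= inverse_process D u w by exact: (le_inverse_process2 (ltW tu) pu).
have ux : inverse_process D u w < x + dl.
  apply: le_lt_trans sx; apply: ge_inf; last by split.
  by exists 0 => z [/ltW].
move: xu; rewrite le_eqVlt => /predU1P[<-|xu]; first by rewrite subrr normr0.
by apply: Hdl => //; rewrite /ball/= ltr0_norm ?subr_lt0// opprB ltrBlDl.
Unshelve. all: by end_near. Qed.

End fractional_poisson.

(** * Second-order structure of the fractional Poisson process *)

Section subordinated_moments.
Context {d : measure_display} {T : measurableType d} {R : realType}.
Variables (P : probability T R) (X Y : R -> T -> R).
Hypothesis mX : forall t, 0 <= t -> measurable_fun setT (X t).
Hypothesis rcX : forall w t, 0 <= t -> X u w @[u --> t^'+] --> X t w.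
Hypothesis mY : forall t, 0 <= t -> measurable_fun setT (Y t).
Hypothesis Y0 : forall w t, 0 <= t -> 0 <= Y t w.
Hypothesis XY : independent_processes P X Y.

Let neg : set R := `]-oo, 0[%classic.

Local Open Scope ereal_scope.

(** Conditioning on Y turns the probability of a negative value into an average
of the probabilities that X_u < 0. *)
Lemma subordinated_ae_ge0 (t : R) :
  (forall u, (0 <= u)%R -> {ae P, forall w, (0 <= X u w)%R}) -> (0 <= t)%R ->
  {ae P, forall w, (0 <= X (Y t w) w)%R}.
Proof.
move=> X0 t0; have mXY := measurable_subordinated mX rcX mY Y0 t0.
apply/(ae_ge0P P mXY).
have mneg : measurable neg by exact: measurable_itv.
have mF : measurable_fun setT (fun z : R * R => (\1_neg z.2 : R)%:E).
  apply/measurable_EFinP; exact: measurableT_comp (measurable_indic mneg) measurable_snd.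
have F0 (z : R * R) : 0 <= (\1_neg z.2 : R)%:E by rewrite lee_fin.
have [_] := integral_subordinated mX rcX mY Y0 XY mF F0 t0 t0.
have indE (Z : T -> R) : measurable_fun setT Z ->
    \int[P]_w (\1_neg (Z w) : R)%:E = P (Z @^-1` neg).
  move=> mZ; rewrite -[in RHS](setIT (Z @^-1` neg)) -integral_indic//.
  exact: measurable_preimage.
rewrite /= indE// => ->; apply: integral0_eq => w _.
rewrite indE; last by apply: mX; exact: Y0.
apply/(ae_ge0P P); first by apply: mX; exact: Y0.
by apply: X0; exact: Y0.
Qed.

Lemma integral_norm_subordinated (t : R) : (0 <= t)%R ->
  \int[P]_w `|X (Y t w) w|%:E = \int[P]_w' \int[P]_w `|X (Y t w') w|%:E.
Proof.
move=> t0.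
have mF : measurable_fun setT (fun z : R * R => `|z.2|%:E).
  by apply/measurable_EFinP; exact: measurableT_comp measurable_snd.
by have [_ ->] := integral_subordinated mX rcX mY Y0 XY mF (fun=> normr_ge0 _) t0 t0.
Qed.

Lemma integral_mul_subordinated (s t : R) : (0 <= s)%R -> (0 <= t)%R ->
  measurable_fun setT (fun w' => \int[P]_w `|X (Y s w') w * X (Y t w') w|%:E) /\
  \int[P]_w `|X (Y s w) w * X (Y t w) w|%:E =
  \int[P]_w' \int[P]_w `|X (Y s w') w * X (Y t w') w|%:E.
Proof.
move=> s0 t0.
have mF : measurable_fun setT (fun z : R * R => `|z.1 * z.2|%:E).
  apply/measurable_EFinP; apply: measurableT_comp => //.
  by apply: measurable_funM; [exact: measurable_fst|exact: measurable_snd].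
exact: (integral_subordinated mX rcX mY Y0 XY mF (fun=> normr_ge0 _) s0 t0).
Qed.

End subordinated_moments.

Section fractional_poisson_second_order.
Context {d : measure_display} {T : measurableType d} {R : realType}.
Variables (P : probability T R) (beta lambda : R) (D N : R -> {RV P >-> R}).
Hypothesis beta01 : 0 < beta < 1.
Hypothesis lambda0 : 0 < lambda.
Hypothesis D_stable : stable_subordinator beta D.
Hypothesis N_poisson : poisson_process lambda N.
Hypothesis N_indep : independent_processes P (fun t => N t) (inverse_process D).

Let E : R -> T -> R := inverse_process D.
Let subD := stable_sub D_stable.
Let levyN := poisson_levy N_poisson.

Let mN t : (0 <= t)%R -> measurable_fun setT (N t). Proof. by []. Qed.

Let rcN w t : (0 <= t)%R -> N u w @[u --> t^'+] --> N t w.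
Proof. by have [rc _] := levy_cadlag levyN w; exact: rc. Qed.

Let mE t : 0 <= t -> measurable_fun setT (E t).
Proof. by move=> _; exact: measurable_inverse_process. Qed.

Let E0 w t : 0 <= t -> 0 <= E t w.
Proof. by move=> _; exact: inverse_process_ge0. Qed.

Lemma measurable_fpp t : 0 <= t -> measurable_fun setT (fpp D N t).
Proof. exact: (measurable_subordinated mN rcN mE E0). Qed.

Local Open Scope ereal_scope.

Let N_ge0 t : (0 <= t)%R -> {ae P, forall w, (0 <= N t w)%R}.
Proof.
rewrite le_eqVlt => /predU1P[<-|t0].
  by apply: aeW => w; rewrite levy_start.
apply: (@poisson_ge0 _ _ _ P (lambda * t)); first by rewrite mulr_gt0.
by move=> k; exact: (poisson_law N_poisson).
Qed.

Let N_sqr t : (0 <= t)%R -> \int[P]_w (N t w ^+ 2)%:E < +oo.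
Proof.
rewrite le_eqVlt => /predU1P[<-|t0].
  under eq_integral do rewrite levy_start// expr0n/=.
  by rewrite integral0 ltry.
apply: (@poisson_sqr_lty _ _ _ P (lambda * t)); first by rewrite mulr_gt0.
by move=> k; exact: (poisson_law N_poisson).
Qed.

(** Given E, the mean of X_u X_w is v E_u + m^2 E_u E_w, where m and v are the
mean and the variance of N per unit of time. So b is the contribution of the
fluctuations of N, and a^2 < 2 c says that the leading term of the variance of X
does not vanish, which is the strict inequality C1^2 < C2. *)
Lemma fpp_second_order : exists a b c : R,
  [/\ (0 < a)%R, (0 <= b)%R, (a ^+ 2 < 2 * c)%R,
    forall t, (0 <= t)%R -> {ae P, forall w, (0 <= fpp D N t w)%R} &
  [/\ forall t, (0 <= t)%R ->
        \int[P]_w `|fpp D N t w|%:E = (a * t `^ beta)%:E,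
      forall t, (0 <= t)%R ->
        \int[P]_w `|fpp D N t w * fpp D N t w|%:E =
          (b * t `^ beta + 2 * c * (t `^ beta) ^+ 2)%:E &
      forall u v, (0 <= u)%R -> (u <= v)%R ->
        (b * u `^ beta + c * (u `^ beta) ^+ 2 +
           a ^+ 2 * (u `^ beta * (v - u) `^ beta))%:E
          <= \int[P]_w `|fpp D N u w * fpp D N v w|%:E
          <= (b * u `^ beta + c * (u `^ beta) ^+ 2 +
           a ^+ 2 * (u `^ beta * v `^ beta))%:E]].
Proof.
have [C1 [C2 [C1_gt0 C12 h1E h2E kE]]] := stable_inverse_second_order beta01 D_stable.
have [m [v [m0 v0 NE NNE]]] := levy_moments levyN N_ge0 N_sqr.
have m_gt0 : (0 < m)%R.
  have l1 : (0 < lambda * 1)%R by rewrite mulr1.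
  have := poisson_mean_gt0 l1 (fun k => poisson_law N_poisson k ltr01).
  by rewrite NE// mulr1 lte_fin.
have meanE t : (0 <= t)%R -> has_mean P (E t) (C1 * t `^ beta)%R.
  by move=> t0; split; [exact: mE|move=> w; exact: E0|exact: h1E].
have mean2 u w : (0 <= u)%R -> (u <= w)%R ->
    \int[P]_x `|fpp D N u x * fpp D N w x|%:E =
    (v * C1 * u `^ beta)%:E + (m ^+ 2)%:E * \int[P]_x (E u x * E w x)%:E.
  move=> u0 uw; have w0 := le_trans u0 uw.
  have mEE : measurable_fun setT (fun x => E u x * E w x)%R.
    by apply: measurable_funM; exact: mE.
  have EE0 x : (0 <= E u x * E w x)%R by rewrite mulr_ge0// E0.
  have [_ _ e1] := has_meanZ v0 (meanE u u0).
  have [mI ->] := integral_mul_subordinated mN rcN mE E0 N_indep u0 w0.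
  rewrite -mulrA -e1 -ge0_integralM_EFin ?sqr_ge0//.
  rewrite -ge0_integralD_EFin//; last 4 first.
  - by apply: measurable_funM => //; exact: mE.
  - exact: measurable_funM.
  - by move=> x; rewrite mulr_ge0// E0.
  - by move=> x; rewrite mulr_ge0// sqr_ge0.
  apply: ge0_ae_eq_integral => //.
  - apply/measurable_EFinP; apply: measurable_funD; apply: measurable_funM => //.
    exact: mE.
  - by move=> x _; apply: integral_ge0 => y _; rewrite lee_fin.
  - by move=> x _; rewrite lee_fin addr_ge0 ?mulr_ge0 ?sqr_ge0 ?E0.
  - apply: filterS (inverse_homo_ae D_stable uw) => x Exx _.
    by rewrite NNE ?E0// mulrA.
exists (m * C1)%R, (v * C1)%R, (m ^+ 2 * C2 / 2)%R; split.
- exact: mulr_gt0.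
- by rewrite mulr_ge0// ltW.
- have : (m ^+ 2 * C1 ^+ 2 < m ^+ 2 * C2)%R by rewrite ltr_pM2l// exprn_gt0.
  by rewrite exprMn; lra.
- by move=> t t0; apply: (subordinated_ae_ge0 mN rcN mE E0 N_indep N_ge0 t0).
split.
- move=> t t0; rewrite (integral_norm_subordinated mN rcN mE E0 N_indep t0).
  under eq_integral do rewrite NE ?E0//.
  by have [_ _ ->] := has_meanZ m0 (meanE t t0); rewrite mulrA.
- move=> t t0; rewrite mean2//.
  under eq_integral do rewrite -expr2.
  by rewrite h2E// -EFinM -EFinD; congr (_%:E); field.
- move=> u w u0 uw; rewrite mean2//; have /andP[lo hi] := kE u w u0 uw.
  have w0 := le_trans u0 uw.
  have k_fin : \int[P]_x (E u x * E w x)%:E \is a fin_num.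
    rewrite ge0_fin_numE; first by rewrite (le_lt_trans hi)// ltry.
    by apply: integral_ge0 => x _; rewrite lee_fin mulr_ge0 ?E0.
  have [kk kkE] : exists kk : R, \int[P]_x (E u x * E w x)%:E = kk%:E.
    by exists (fine (\int[P]_x (E u x * E w x)%:E)); rewrite fineK.
  rewrite kkE in lo hi *; move: lo hi; rewrite -EFinM -EFinD !lee_fin => lo hi.
  have m2 : (0 <= m ^+ 2)%R by exact: sqr_ge0.
  have lo' := ler_wpM2l m2 lo; have hi' := ler_wpM2l m2 hi.
  by apply/andP; split; lra.
Qed.

End fractional_poisson_second_order.

(** * Moments of the gamma process *)

Section density.
Context {d : measure_display} {T : measurableType d} {R : realType}.
Variables (P : probability T R) (X : T -> R) (C : set R) (p f : R -> R).
Hypothesis mX : measurable_fun setT X.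
Hypothesis mC : measurable C.
Hypothesis mp : measurable_fun setT p.
Hypothesis p0 : forall y, 0 <= p y.
Hypothesis X_law : forall B, measurable B ->
  (P (X @^-1` B) = \int[lebesgue_measure]_(y in B `&` C) (p y)%:E)%E.
Hypothesis mf : measurable_fun setT f.
Hypothesis f0 : forall y, 0 <= f y.

Let q : R -> R := p \* \1_C.

Let q0 y : 0 <= q y. Proof. by rewrite /q/= mulr_ge0. Qed.

Let mq : measurable_fun setT q. Proof. exact: measurable_funM. Qed.

Local Notation leb := (@lebesgue_measure R).

(** The density restricted to C, on the layer of f above s. *)
Let H (s y : R) : R := if (0 <= s) && (s < f y) then q y else 0.

Let H0 s y : 0 <= H s y. Proof. by rewrite /H; case: ifP. Qed.

Let mH : measurable_fun setT (fun z : R * R => H z.1 z.2).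
Proof.
apply: measurable_fun_ifT => //.
- apply: measurable_and; first by apply: measurable_fun_ler.
  apply: measurable_fun_ltr => //.
  exact: measurableT_comp mf measurable_snd.
- exact: measurableT_comp mq measurable_snd.
Qed.

Local Open Scope ereal_scope.

(** The layer-cake formula reduces the claim to indicators of measurable sets,
for which it is the law of X, and Tonelli exchanges the layers and the
density. *)
Lemma integral_density :
  \int[P]_w (f (X w))%:E = \int[leb]_(y in C) (f y * p y)%:E.
Proof.
rewrite ge0_integral_tail//; last exact: measurableT_comp.
transitivity (\int[leb]_s \int[leb]_y (H s y)%:E).
  rewrite integral_mkcond; apply: eq_integral => s _.
  rewrite patchE mem_setE in_itv/= andbT; case: ifPn => s0; last first.
    by rewrite integral0_eq// => y _; rewrite /H (negbTE s0).
  have -> : [set w | (s < f (X w))%R] = X @^-1` [set y | (s < f y)%R] by [].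
  have ms : measurable [set y | (s < f y)%R].
    have := mf measurableT (measurable_itv `]s, +oo[%R).
    rewrite setTI (_ : f @^-1` _ = [set y | (s < f y)%R])//.
    by apply/seteqP; split => y /=; rewrite in_itv/= andbT.
  rewrite X_law// integral_mkcond; apply: eq_integral => y _.
  rewrite patchE /H s0/= /q/= indicE in_setI.
  have -> : (y \in [set y | (s < f y)%R]) = (s < f y)%R.
    by apply/idP/idP; rewrite inE.
  by case: (s < f y)%R => //=; case: (y \in C); rewrite /= ?mulr1 ?mulr0.
have mHE : measurable_fun setT (fun z : R * R => (H z.1 z.2)%:E).
  exact/measurable_EFinP.
have H0E (z : R * R) : 0 <= (H z.1 z.2)%:E by rewrite lee_fin.
rewrite (fubini_tonelli (m1 := leb) (m2 := leb) _ mHE H0E)/=.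
rewrite [RHS]integral_mkcond; apply: eq_integral => y _.
transitivity (\int[leb]_(s in `[0%R, f y[) (q y)%:E).
  rewrite [RHS]integral_mkcond; apply: eq_integral => s _.
  by rewrite patchE mem_setE in_itv/= /H; case: ifP.
rewrite integral_cst//= lebesgue_measure_itv/= patchE /q/= indicE.
case: ifPn => fy; case: ifPn => yC; rewrite ?mulr1 ?mulr0 ?mul0e ?mule0//.
  by rewrite sube0 -EFinM mulrC.
move: fy; rewrite -leNgt lee_fin => fy.
have -> : f y = 0%R by apply/eqP; rewrite eq_le fy f0.
by rewrite mul0r.
Qed.

End density.

Section gamma_moments.
Context {d : measure_display} {T : measurableType d} {R : realType}.
Variables (P : probability T R) (alpha p : R) (G : R -> {RV P >-> R}).
Hypothesis alpha0 : 0 < alpha.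
Hypothesis p0 : 0 < p.
Hypothesis G_gamma : gamma_process alpha p G.

Local Notation leb := (@lebesgue_measure R).

Let gamma_fun_ge0 (b : R) : 0 <= gamma_fun b.
Proof. by apply: Rintegral_ge0 => x _; rewrite mulr_ge0 ?powR_ge0 ?expR_ge0. Qed.

Let pdf_ge0 (b y : R) : 0 <= gamma_pdf alpha b y.
Proof.
by rewrite /gamma_pdf !mulr_ge0 ?powR_ge0 ?expR_ge0 ?invr_ge0 ?gamma_fun_ge0.
Qed.

Let mpdf (b : R) : measurable_fun setT (gamma_pdf alpha b).
Proof.
apply: measurable_funM; first by apply: measurable_funM => //; exact: measurable_powR.
by apply: measurableT_comp => //; apply: measurableT_comp => //; exact: measurable_funM.
Qed.

Let total (t : R) : 0 < t ->
  (\int[leb]_(y in `]0%R, +oo[) (gamma_pdf alpha (p * t) y)%:E = 1)%E.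
Proof.
move=> t0; have := gamma_law G_gamma t0 measurableT.
by rewrite preimage_setT probability_setT setTI => ->.
Qed.

(** Otherwise the density would be 0 and its total mass would not be 1. *)
Let gamma_fun_gt0 (t : R) : 0 < t -> 0 < gamma_fun (p * t).
Proof.
move=> t0; rewrite lt_neqAle gamma_fun_ge0 andbT eq_sym; apply/eqP => g0.
have := total t0; rewrite integral0_eq.
  by move=> [] /eqP; rewrite eq_sym oner_eq0.
by move=> y _; rewrite /gamma_pdf g0 invr0 mulr0 !mul0r.
Qed.

(** y^2 times the density of G_t is a multiple of the density of G_s, where
s = t + 2/p has a shape larger by 2; and densities have a finite total mass. *)
Lemma gamma_sqr_lty (t : R) : 0 <= t -> (\int[P]_w (G t w ^+ 2)%:E < +oo)%E.
Proof.
have levyG := subordinator_levy (gamma_sub G_gamma).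
rewrite le_eqVlt => /predU1P[<-|t0].
  under eq_integral do rewrite levy_start// expr0n/=.
  by rewrite integral0 ltry.
rewrite (@integral_density _ _ _ P (G t) `]0, +oo[ (gamma_pdf alpha (p * t))
  (fun x => x ^+ 2))//; last 2 first.
- by move=> B mB; exact: (gamma_law G_gamma t0).
- by move=> y; exact: sqr_ge0.
pose s := t + 2 / p; have s0 : 0 < s by rewrite addr_gt0 ?divr_gt0.
have ps : p * s = p * t + 2 by rewrite /s; field; rewrite gt_eqF.
pose K := alpha `^ (p * t) / gamma_fun (p * t) * gamma_fun (p * s) / alpha `^ (p * s).
have K0 : 0 <= K by rewrite !mulr_ge0 ?invr_ge0 ?powR_ge0 ?gamma_fun_ge0.
have -> : (\int[leb]_(y in `]0%R, +oo[) (y ^+ 2 * gamma_pdf alpha (p * t) y)%:E =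
    \int[leb]_(y in `]0%R, +oo[) (K%:E * (gamma_pdf alpha (p * s) y)%:E))%E.
  apply: eq_integral => y; rewrite inE/= in_itv/= andbT => y0.
  rewrite -EFinM; congr EFin; rewrite /gamma_pdf /K.
  have -> : y `^ (p * s - 1) = y ^+ 2 * y `^ (p * t - 1).
    rewrite ps (_ : p * t + 2 - 1 = 2%:R + (p * t - 1)); last by ring.
    by rewrite powRD ?powR_mulrn ?(ltW y0)//; rewrite (gt_eqF y0) implybT.
  have := gamma_fun_gt0 s0; have := gamma_fun_gt0 t0; have : 0 < alpha `^ (p * s).
    by rewrite powR_gt0.
  move=> h1 h2 h3; field.
  by rewrite !gt_eqF.
rewrite ge0_integralZl_EFin//; last 2 first.
- by move=> y _; rewrite lee_fin.
- by apply: measurable_funTS; apply/measurable_EFinP; exact: mpdf.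
by rewrite total// mule1 ltry.
Qed.

(** If the mean were 0, then G_t would vanish almost surely; but its law has no
mass outside ]0, +oo[. *)
Lemma gamma_mean_gt0 (t : R) : 0 < t -> (0 < \int[P]_w `|G t w|%:E)%E.
Proof.
move=> t0; rewrite lt_neqAle integral_ge0 ?andbT//; apply/eqP => /esym int0.
have neg : P (G t @^-1` `]-oo, 0]) = 0%E.
  rewrite (gamma_law G_gamma t0)//.
  rewrite (_ : _ `&` _ = set0) ?integral_set0// -subset0 => y [/=].
  by rewrite !in_itv/= andbT => y1 /(le_lt_trans y1); rewrite ltxx.
have pos : P (G t @^-1` `]0, +oo[) = 0%E.
  have mG : measurable_fun setT (fun w => (G t w)%:E) by exact/measurable_EFinP.
  have /(ae_eq_integral_abs P measurableT mG) ae0 : (\int[P]_w `|(G t w)%:E| = 0)%E.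
    by [].
  apply: (negligibleP _ (measurable_preimage _ _)).1 => //.
  by apply: negligibleS ae0 => w /=; rewrite in_itv/= andbT => w0 /(_ I) [] Gw;
    rewrite Gw ltxx in w0.
have : P setT = 0%E.
  rewrite (_ : setT = G t @^-1` `]-oo, 0] `|` G t @^-1` `]0, +oo[).
    rewrite measureU; first by rewrite [X in (X + _)%E]neg [X in (_ + X)%E]pos adde0.
    - exact: measurable_preimage.
    - exact: measurable_preimage.
    by rewrite -subset0 => w /= []; rewrite !in_itv/= andbT leNgt => /negP.
  apply/seteqP; split => // w _ /=; rewrite !in_itv/= andbT.
  by case: (leP (G t w) 0) => h; [left|right].
by rewrite probability_setT => -[] /eqP; rewrite oner_eq0.
Qed.

End gamma_moments.

Lemma gamma_second_order {d : measure_display} {T : measurableType d}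
    {R : realType} (P : probability T R) (alpha p : R) (G : R -> {RV P >-> R}) :
    0 < alpha -> 0 < p -> gamma_process alpha p G -> exists m v : R, [/\ 0 < m, 0 <= v,
  forall t, 0 <= t -> has_mean P (G t) (m * t) &
  forall t, 0 <= t -> has_mean P (fun w => G t w ^+ 2) (v * t + m ^+ 2 * t ^+ 2)].
Proof.
move=> alpha0 p0 G_gamma; have subG := gamma_sub G_gamma.
have G0 w t : 0 <= t -> 0 <= G t w by exact: subordinator_ge0.
have G_ge0 t : 0 <= t -> {ae P, forall w, 0 <= G t w}.
  by move=> t0; apply: aeW => w; exact: G0.
have [m [v [m0 v0 GE GGE]]] := levy_moments (subordinator_levy subG) G_ge0
  (gamma_sqr_lty alpha0 p0 G_gamma).
exists m, v; split => //.
- by have := gamma_mean_gt0 G_gamma ltr01; rewrite GE// mulr1 lte_fin.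
- move=> t t0; split => //; first by move=> w; exact: G0.
  by rewrite -GE//; apply: eq_integral => w _; rewrite ger0_norm ?G0.
- move=> t t0; split; [exact: measurable_funX|by move=> w; exact: sqr_ge0|].
  rewrite (_ : v * t + m ^+ 2 * t ^+ 2 = v * t + m ^+ 2 * t * t); last by ring.
  rewrite -GGE//; apply: eq_integral => w _.
  by rewrite -expr2 ger0_norm ?sqr_ge0.
Qed.

(** * Fractional moments of a subordinator *)

Section has_mean_extra.
Context {d : measure_display} {T : measurableType d} {R : realType}.
Variable P : probability T R.

Lemma has_mean_uniq (f : T -> R) (m n : R) : has_mean P f m -> has_mean P f n -> m = n.
Proof. by move=> [_ _ fm] [_ _ fn]; apply: EFin_inj; rewrite -fm fn. Qed.

Lemma has_mean_ge0 (f : T -> R) (m : R) : has_mean P f m -> 0 <= m.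
Proof.
by move=> [_ f0 fm]; rewrite -lee_fin -fm integral_ge0// => w _; rewrite lee_fin.
Qed.

Lemma has_mean_eq (f g : T -> R) (m : R) : f =1 g -> has_mean P f m -> has_mean P g m.
Proof. by move=> /funext->. Qed.

Lemma has_mean0_ae (f : T -> R) : has_mean P f 0 -> {ae P, forall w, f w = 0}.
Proof.
move=> [mf f0 fm].
have mf' : measurable_fun setT (fun w => (f w)%:E) by exact/measurable_EFinP.
have /(ae_eq_integral_abs P measurableT mf') : (\int[P]_w `|(f w)%:E| = 0)%E.
  by rewrite -[RHS]fm; apply: eq_integral => w _; rewrite gee0_abs ?lee_fin.
by apply: filterS => w /(_ I)[].
Qed.

End has_mean_extra.

Section power_moments.
Context {d : measure_display} {T : measurableType d} {R : realType}.
Variables (P : probability T R) (beta m v : R) (G : R -> {RV P >-> R}).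
Hypothesis beta01 : 0 < beta < 1.
Hypothesis m0 : 0 < m.
Hypothesis v0 : 0 <= v.
Hypothesis subG : subordinator G.
Hypothesis meanG : forall t, 0 <= t -> has_mean P (G t) (m * t).
Hypothesis sqrG : forall t, 0 <= t ->
  has_mean P (fun w => G t w ^+ 2) (v * t + m ^+ 2 * t ^+ 2).

Let levyG := subordinator_levy subG.
Let b0 : 0 < beta. Proof. by have /andP[] := beta01. Qed.
Let G0 t w : 0 <= t -> 0 <= G t w. Proof. exact: subordinator_ge0. Qed.

Let mpow t : measurable_fun setT (fun w => G t w `^ beta).
Proof. exact: measurableT_comp (measurable_powR _) _. Qed.

Let pow_le (x : R) : 0 <= x -> x `^ beta <= 1 + x.
Proof.
move=> x0; have x1 : 0 <= 1 + x by rewrite addr_ge0.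
apply: (@le_trans _ _ ((1 + x) `^ beta)).
  by apply: ge0_ler_powR; rewrite ?nnegrE ?(ltW b0)// lerDr.
by apply: ler1_powR; [rewrite lerDl|have /andP[_ /ltW] := beta01].
Qed.

Definition power_mean t := fine (\int[P]_w (G t w `^ beta)%:E)%E.
Definition power_sqr_mean t := fine (\int[P]_w ((G t w `^ beta) ^+ 2)%:E)%E.
Local Notation mu := power_mean.
Local Notation nu := power_sqr_mean.

Lemma has_power_mean t : 0 <= t -> has_mean P (fun w => G t w `^ beta) (mu t).
Proof.
move=> t0; apply: (has_mean_dominated (g := fun w => cst 1 w + G t w)) => //.
- by move=> w; exact: powR_ge0.
- exact: has_meanD (has_mean_cst P ler01) (meanG t0).
- by move=> w; apply: pow_le; exact: G0.
Qed.

Lemma has_power_sqr_mean t : 0 <= t ->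
  has_mean P (fun w => (G t w `^ beta) ^+ 2) (nu t).
Proof.
move=> t0; apply: (has_mean_dominated
    (g := fun w => cst 2 w + 2 * G t w ^+ 2)) => //.
- exact: measurable_funX.
- by move=> w; exact: sqr_ge0.
- exact: has_meanD (has_mean_cst P (ler0n _ 2)) (has_meanZ (ler0n _ 2) (sqrG t0)).
- move=> w /=; have p1 := powR_ge0 (G t w) beta; have p2 := pow_le (G0 w t0).
  have := G0 w t0; set x := G t w in p1 p2 *; set y := _ `^ _ in p1 p2 *.
  by have := sqr_ge0 (x - 1); nra.
Qed.

(** The variance, obtained by uniqueness of the mean of
G_t^2 + (m t)^2 = (G_t - m t)^2 + 2 m t G_t, which involves only nonnegative
terms. *)
Lemma centered_sqr_mean t : 0 <= t ->
  has_mean P (fun w => (G t w - m * t) ^+ 2) (v * t).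
Proof.
move=> t0; have mt0 : 0 <= m * t by rewrite mulr_ge0// ltW.
have h1 := has_meanD (sqrG t0) (has_mean_cst P (sqr_ge0 (m * t))).
have h2 : has_mean P (fun w => (G t w - m * t) ^+ 2)
    (fine (\int[P]_w ((G t w - m * t) ^+ 2)%:E)).
  apply: (has_mean_dominated _ _ h1).
  - by apply: measurable_funX; exact: measurable_funB.
  - by move=> w; exact: sqr_ge0.
  - by move=> w /=; have := G0 w t0; nra.
have h3 := has_meanD h2 (has_meanZ (mulr_ge0 (ler0n _ 2) mt0) (meanG t0)).
have e : has_mean P (fun w => G t w ^+ 2 + cst ((m * t) ^+ 2) w)
   (fine (\int[P]_w ((G t w - m * t) ^+ 2)%:E) + 2 * (m * t) * (m * t)).
  by apply: has_mean_eq h3 => w /=; ring.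
have := has_mean_uniq h1 e => E.
have <- : fine (\int[P]_w ((G t w - m * t) ^+ 2)%:E) = v * t by lra.
exact: h2.
Qed.

Lemma power_mean_gt0 t : 0 < t -> 0 < mu t.
Proof.
move=> t0; have t0' := ltW t0; have h := has_power_mean t0'.
rewrite lt_neqAle (has_mean_ge0 h) andbT eq_sym; apply/eqP => e0.
rewrite e0 in h; have ae0 := has_mean0_ae h.
have [mG _ E] := meanG t0'.
have : (\int[P]_w (G t w)%:E = \int[P]_w (cst 0 w)%:E)%E.
  apply: ae_eq_integral_EFin => //; first by move=> w; exact: G0.
  by apply: filterS ae0 => w /powR_eq0_eq0.
rewrite E integral0 => -[] /eqP; rewrite mulf_eq0 !gt_eqF//.
Qed.

Lemma power_mean_sqr_le t : 0 <= t -> mu t ^+ 2 <= nu t.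
Proof.
move=> t0; have [m1 p1 e1] := has_power_mean t0.
by have [_ _ e2] := has_power_sqr_mean t0; exact: le_integral_sqr m1 p1 e1 e2.
Qed.

Let rate := 1 + v / m ^+ 2.

Let rate_ge1 : 1 <= rate.
Proof. by rewrite lerDl divr_ge0// sqr_ge0. Qed.

(** Let y = G_t / (m t). Then |y^beta - 1| <= |y - 1|, and Young's inequality
bounds |y - 1| by (1/r + r (y - 1)^2) / 2, where the mean of (y - 1)^2 is of
order 1/t; the choice r = sqrt t balances the two terms. *)
Lemma normalized_power_means t : 1 <= t ->
  `|mu t / (m * t) `^ beta - 1| <= rate / Num.sqrt t /\
  `|nu t / ((m * t) `^ beta) ^+ 2 - 1| <= 2 * rate / Num.sqrt t.
Proof.
move=> t1; have t0 : 0 < t by exact: lt_le_trans t1.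
have t0' := ltW t0.
have mt0 : 0 < m * t by exact: mulr_gt0.
pose q := (m * t) `^ beta; have q0 : 0 < q by exact: powR_gt0.
pose r := Num.sqrt t; have r0 : 0 < r by rewrite sqrtr_gt0.
have r2 : r ^+ 2 = t by rewrite sqr_sqrtr.
have r1 : 1 <= r by rewrite -(@sqrtr1 R) ler_sqrt.
pose y w := G t w / (m * t).
have y0 w : 0 <= y w by rewrite divr_ge0 ?G0// ltW.
have yq w : y w `^ beta = q^-1 * G t w `^ beta.
  rewrite /y powRM ?G0 ?invr_ge0 ?(ltW mt0)// mulrC -powR_inv1 ?(ltW mt0)//.
  by rewrite powRAC powR_inv1 ?(ltW q0).
have hy2 : has_mean P (fun w => (y w - 1) ^+ 2) ((m * t) ^- 2 * (v * t)).
  apply: has_mean_eq (has_meanZ _ (centered_sqr_mean t0')) => [w|].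
    by rewrite /y; field; rewrite !gt_eqF.
  by rewrite invr_ge0 exprn_ge0// ltW.
have eE : (m * t) ^- 2 * (v * t) = v / m ^+ 2 / r ^+ 2.
  by rewrite r2; field; rewrite !gt_eqF.
rewrite {}eE in hy2; set ep := _ / r ^+ 2 in hy2.
have A1 : has_mean P (fun w => y w `^ beta) (q^-1 * mu t).
  apply: has_mean_eq (has_meanZ _ (has_power_mean t0')) => [w|]; first by rewrite yq.
  by rewrite invr_ge0 ltW.
have A2 : has_mean P (fun w => (y w `^ beta) ^+ 2) (q^-1 ^+ 2 * nu t).
  apply: has_mean_eq (has_meanZ _ (has_power_sqr_mean t0')) => [w|].
    by rewrite yq exprMn.
  by rewrite sqr_ge0.
have young w : `|y w - 1| <= (r^-1 + r * (y w - 1) ^+ 2) / 2.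
  have : 0 <= (r * `|y w - 1| - 1) ^+ 2 / r by rewrite divr_ge0 ?sqr_ge0 ?ltW.
  rewrite -(real_normK (num_real (y w - 1))).
  have -> : (r * `|y w - 1| - 1) ^+ 2 / r =
      r * `|y w - 1| ^+ 2 - 2 * `|y w - 1| + r^-1 by field; rewrite gt_eqF.
  lra.
have dev w := le_trans (powR_sub1_le beta01 (y0 w)) (young w).
pose B w := cst (r^-1 / 2) w + r / 2 * (y w - 1) ^+ 2.
have rV0 : 0 <= r^-1 by rewrite invr_ge0 ltW.
have hB : has_mean P B (r^-1 / 2 + r / 2 * ep).
  have d1 : 0 <= r^-1 / 2 by rewrite divr_ge0.
  have d2 : 0 <= r / 2 by rewrite divr_ge0// ltW.
  exact: has_meanD (has_mean_cst P d1) (has_meanZ d2 hy2).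
have eB : r^-1 / 2 + r / 2 * ep = rate / r / 2.
  by rewrite /ep /rate; field; rewrite !gt_eqF.
have BE w : B w = (r^-1 + r * (y w - 1) ^+ 2) / 2 by rewrite /B/=; field; rewrite gt_eqF.
have one := has_mean_cst P ler01.
have up1 := has_mean_le A1 (has_meanD one hB) _.
have lo1 := has_mean_le one (has_meanD A1 hB) _.
have hB2 := has_meanD hy2 (has_meanZ (ler0n _ 2) hB).
have up2 := has_mean_le A2 (has_meanD one hB2) _.
have lo2 := has_mean_le one (has_meanD A2 hB2) _.
have dev2 w : `|(y w `^ beta) ^+ 2 - 1| <= (y w - 1) ^+ 2 + 2 * B w.
  have h1 := powR_sub1_le beta01 (y0 w); have h2 := young w.
  rewrite -BE in h2; rewrite -(real_normK (num_real (y w - 1))).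
  have -> : (y w `^ beta) ^+ 2 - 1 =
      (y w `^ beta - 1) * ((y w `^ beta - 1) + 2) by ring.
  rewrite normrM; have h3 := ler_normD (y w `^ beta - 1) 2.
  rewrite [`|2|]ger0_norm// in h3.
  have n0 := normr_ge0 (y w `^ beta - 1).
  set a := `|y w `^ beta - 1| in h1 h3 n0 *; set b := `|y w - 1| in h1 h2 *.
  have : a * `|y w `^ beta - 1 + 2| <= a * (a + 2) by rewrite ler_wpM2l.
  nra.
have ep_le : ep <= rate / r.
  rewrite /ep ler_pdivrMr ?exprn_gt0// expr2 mulrA divfK ?gt_eqF//.
  apply: (@le_trans _ _ rate); first by rewrite /rate lerDr.
  by rewrite ler_peMr// (le_trans ler01).
have rr0 : 0 <= rate / r by rewrite divr_ge0 ?(ltW r0)// (le_trans ler01).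
rewrite {}eB in up1 lo1 up2 lo2.
have mE : mu t / q = q^-1 * mu t by rewrite mulrC.
have nE : nu t / q ^+ 2 = q^-1 ^+ 2 * nu t by rewrite mulrC exprVn.
rewrite -/q -/r mE nE !ler_norml -[2 * rate / r]mulrA; split; apply/andP; split.
- have := lo1; move=> /(_ _)/wrap[]; last by lra.
  by move=> w /=; have := dev w; rewrite -BE ler_norml => /andP[]; lra.
- have := up1; move=> /(_ _)/wrap[]; last by lra.
  by move=> w /=; have := dev w; rewrite -BE ler_norml => /andP[]; lra.
- have := lo2; move=> /(_ _)/wrap[]; last by lra.
  by move=> w /=; have := dev2 w; rewrite ler_norml => /andP[]; lra.
- have := up2; move=> /(_ _)/wrap[]; last by lra.
  by move=> w /=; have := dev2 w; rewrite ler_norml => /andP[]; lra.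
Qed.

(** The increment is independent of G_s and has the law of G_(t-s). *)
Lemma has_mean_increment (s t M Z : R) (f g : R -> R) : 0 <= s -> s <= t ->
  measurable_fun setT f -> measurable_fun setT g ->
  (forall x, 0 <= f x) -> (forall x, 0 <= g x) ->
  has_mean P (fun w => f (G s w)) M -> has_mean P (fun w => g (G (t - s) w)) Z ->
  has_mean P (fun w => f (G s w) * g (G t w - G s w)) (M * Z).
Proof.
move=> s0 st mf mg f0 g0 [m1 _ e1] [m2 _ e2].
have mD : measurable_fun setT (fun w => G t w - G s w) by exact: measurable_funB.
split.
- by apply: measurable_funM; apply: measurableT_comp.
- by move=> w; rewrite mulr_ge0.
rewrite (integral_mul_independent_pair (f := f) (g := g) _ _
  (levy_increment_independent levyG s0 st))// e1 EFinM -e2; congr (_ * _)%E.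
apply: (eq_law_integral (F := fun x => (g x)%:E)) => //.
- move=> B mB; rewrite -(levy_increment_law levyG s0 _ mB) ?subr_ge0//.
  by rewrite subrKC.
- exact/measurable_EFinP.
Qed.

(** Let x = G_t - G_s and y = G_s, so that x has mean 2 K. If x >= K, then
(x + y)^beta - x^beta is at most y times the slope K^(beta-1). If x < K, which
is far below the mean of x, it is at most y^beta, and Chebyshev's factor
(x - 2 K)^2 / K^2 is at least 1. In both cases the sum of the two bounds is
valid; its mean splits by independence of x and y, and is small for large t.
The weight f is 1 for E[G_t^beta], and y^beta for E[G_s^beta G_t^beta]. *)
Lemma cross_power_bounds (s t M A B c : R) (f : R -> R) : 0 <= s -> s < t ->
  measurable_fun setT f -> (forall x, 0 <= f x) ->
  has_mean P (fun w => f (G s w)) M ->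
  has_mean P (fun w => f (G s w) * G s w `^ beta) A ->
  has_mean P (fun w => f (G s w) * G s w) B ->
  has_mean P (fun w => f (G s w) * G t w `^ beta) c ->
  let K := m * (t - s) / 2 in
  M * mu (t - s) <= c <= M * mu (t - s) +
    (A * (v * (t - s) / K ^+ 2) + B * (K `^ beta / K)).
Proof.
move=> s0 st mf f0 hM hA hB hc; set K := m * (t - s) / 2; move=> /=.
have st' := ltW st; have ts0 : 0 <= t - s by rewrite subr_ge0.
have K0 : 0 < K by rewrite divr_gt0 ?mulr_gt0 ?subr_gt0.
have mp : measurable_fun setT (fun x : R => x `^ beta) by exact: measurable_powR.
have fA0 x : 0 <= f x * x `^ beta by rewrite mulr_ge0 ?powR_ge0.
have h1 := has_mean_increment s0 st' mf mp f0 (fun x => powR_ge0 x beta) hM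
  (has_power_mean ts0).
have inc0 w : 0 <= G t w - G s w by rewrite subr_ge0 (subordinator_nd subG).
apply/andP; split.
  apply: has_mean_le h1 hc _ => w; rewrite ler_wpM2l//.
  apply: ge0_ler_powR; rewrite ?nnegrE ?(ltW b0)// ?G0 ?(le_trans s0)//.
  by rewrite gerBl G0.
have m2 : measurable_fun setT (fun x : R => (x - m * (t - s)) ^+ 2).
  by apply: measurable_funX; exact: measurable_funB.
have mfA : measurable_fun setT (fun x : R => f x * x `^ beta) by exact: measurable_funM.
have h2 := has_mean_increment s0 st' mfA m2 fA0 (fun x => sqr_ge0 _) hA
  (centered_sqr_mean ts0).
have KV0 : 0 <= K ^- 2 by rewrite invr_ge0 exprn_ge0// ltW.
have Kb0 : 0 <= K `^ beta / K by rewrite divr_ge0 ?powR_ge0// ltW.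
have h3 := has_meanD h1 (has_meanD (has_meanZ KV0 h2) (has_meanZ Kb0 hB)).
apply: (le_trans (has_mean_le hc h3 _)); last first.
  by rewrite lerD2l [B * _]mulrC lerD2r mulrC -!mulrA lexx.
move=> w; set x := G t w - G s w; set y := G s w.
have -> : G t w = x + y by rewrite /x subrK.
have y0 : 0 <= y by exact: G0.
have fy : 0 <= f y by [].
have -> : f y * x `^ beta +
    (K ^- 2 * (f y * y `^ beta * (x - m * (t - s)) ^+ 2) +
     K `^ beta / K * (f y * y)) =
    f y * (x `^ beta + y `^ beta * ((x - m * (t - s)) ^+ 2 / K ^+ 2) +
           y * (K `^ beta / K)) by ring.
rewrite ler_wpM2l//; have [Kx|xK] := leP K x.
  apply: le_trans (powR_sub_le_lin beta01 K0 Kx y0) _.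
  rewrite lerD2r lerDl mulr_ge0 ?powR_ge0// divr_ge0 ?sqr_ge0//.
apply: le_trans (powR_add_le beta01 (inc0 w) y0) _.
have far : 1 <= (x - m * (t - s)) ^+ 2 / K ^+ 2.
  rewrite ler_pdivlMr ?exprn_gt0// mul1r.
  have -> : m * (t - s) = 2 * K by rewrite /K; field.
  by nra.
have p0 := powR_ge0 y beta.
apply: (@le_trans _ _ (x `^ beta + y `^ beta * ((x - m * (t - s)) ^+ 2 / K ^+ 2))).
  by rewrite lerD2l ler_peMr.
by rewrite lerDl mulr_ge0.
Qed.

End power_moments.

(** * Limits at infinity, covariances and correlations *)

Section limits_at_infinity.
Context {R : realType}.

Lemma powR_inv_cvgy0 (b : R) : 0 < b -> (t `^ b)^-1 @[t --> +oo] --> (0 : R).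
Proof.
move=> b0; apply/cvgrPdist_le => e e0; near=> t.
have t0 : 0 < t by near: t; apply: nbhs_pinfty_gt; rewrite num_real.
have tb : 0 < t `^ b by exact: powR_gt0.
rewrite sub0r normrN ger0_norm ?invr_ge0 ?(ltW tb)//.
rewrite -[leRHS]invrK lef_pV2 ?posrE ?invr_gt0//.
have eV : 0 < e^-1 by rewrite invr_gt0.
rewrite (_ : e^-1 = (e^-1 `^ b^-1) `^ b); last first.
  by rewrite -powRrM mulVf ?gt_eqF// powRr1// ltW.
have tB : e^-1 `^ b^-1 <= t by near: t; apply: nbhs_pinfty_ge; rewrite num_real.
by apply: ge0_ler_powR tB; rewrite ?nnegrE ?(ltW b0) ?(ltW t0) ?powR_ge0.
Unshelve. all: by end_near. Qed.

Lemma cvgy_eq (f g : R -> R) (l r : R) : (forall t, r < t -> f t = g t) ->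
  f t @[t --> +oo] --> l -> g t @[t --> +oo] --> l.
Proof.
move=> fg h; apply: cvg_trans h; apply: near_eq_cvg; near=> t; apply: fg.
by near: t; apply: nbhs_pinfty_gt; rewrite num_real.
Unshelve. all: by end_near. Qed.

Lemma sqrt_inv_cvgy0 : (Num.sqrt t)^-1 @[t --> +oo] --> (0 : R).
Proof.
apply: (cvgy_eq (r := 0) (f := fun t => (t `^ 2^-1)^-1)).
  by move=> t t0; rewrite powR12_sqrt// ltW.
by apply: powR_inv_cvgy0.
Qed.

(** The remainder of [cross_power_bounds] is O(1/K) + O(K^(b-1)), where K grows
linearly in t. *)
Lemma remainder_cvgy0 (b m v s A B : R) : 0 < b < 1 -> 0 < m ->
  A * (v * (t - s) / (m * (t - s) / 2) ^+ 2) +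
  B * ((m * (t - s) / 2) `^ b / (m * (t - s) / 2)) @[t --> +oo] --> (0 : R).
Proof.
move=> /andP[b0 b1] m0.
have Ky : m * (t - s) / 2 @[t --> +oo] --> +oo.
  apply/cvgryPge => M; near=> t.
  have tM : M * 2 / m + s <= t by near: t; apply: nbhs_pinfty_ge; rewrite num_real.
  by rewrite ler_pdivlMr// [m * _]mulrC -ler_pdivrMr// lerBrDr.
have K1 : (m * (t - s) / 2)^-1 @[t --> +oo] --> 0.
  apply: (@cvg_comp _ _ _ (fun t => m * (t - s) / 2) (fun K => K^-1) _ _ _ Ky).
  apply: (cvgy_eq (r := 0) (f := fun t => (t `^ 1)^-1)).
    by move=> t t0; rewrite powRr1// ltW.
  exact: powR_inv_cvgy0.
have K2 : (m * (t - s) / 2) `^ b / (m * (t - s) / 2) @[t --> +oo] --> 0.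
  apply: (@cvg_comp _ _ _ (fun t => m * (t - s) / 2) (fun K => K `^ b / K) _ _ _ Ky).
  apply: (cvgy_eq (r := 0) (f := fun t => (t `^ (1 - b))^-1)).
    move=> t t0; rewrite -powRN opprB powRB ?powRr1 ?(ltW t0)//.
    by rewrite (gt_eqF t0) implybT.
  by apply: powR_inv_cvgy0; rewrite subr_gt0.
apply: (cvgy_eq (r := s) (f := fun t =>
    A * (2 * v / m) * (m * (t - s) / 2)^-1 +
    B * ((m * (t - s) / 2) `^ b / (m * (t - s) / 2)))).
  move=> t st; congr (_ + _); field.
  by rewrite !gt_eqF// subr_gt0.
rewrite -[X in _ --> X](_ : A * (2 * v / m) * 0 + B * 0 = 0); last first.
  by rewrite !mulr0 addr0.
by apply: cvgD; apply: cvgM => //; exact: cvg_cst.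
Unshelve. all: by end_near. Qed.

End limits_at_infinity.

Section covariance_of_moments.
Context {d : measure_display} {T : measurableType d} {R : realType}.
Variable P : probability T R.
Local Open Scope ereal_scope.

Lemma Lfun2_of_sqr (X : T -> R) : measurable_fun setT X ->
  \int[P]_w `|X w * X w|%:E < +oo -> X \in Lfun P 2%:E.
Proof.
move=> mX fin; rewrite inE; apply/andP; split; rewrite inE//=.
rewrite /finite_norm [X in X < _](_ : _ =
    (\int[P]_w `|X w * X w|%:E) `^ 2^-1); first exact: poweR_lty.
rewrite unlock; congr (_ `^ _); apply: eq_integral => w _.
by rewrite /= powR_mulrn// normrM expr2.
Qed.

Lemma expectation_ae_ge0 (X : T -> R) : measurable_fun setT X ->
  {ae P, forall w, (0 <= X w)%R} -> 'E_P[X] = \int[P]_w `|X w|%:E.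
Proof.
move=> mX X0; rewrite unlock; apply: ae_eq_integral => //.
- exact/measurable_EFinP.
- exact/measurable_EFinP/measurableT_comp.
- by apply: filterS X0 => w Xw _; rewrite ger0_norm.
Qed.

(** Almost sure nonnegativity identifies the expectations with integrals of
absolute values, the form in which conditioning produces them. *)
Lemma covariance_ae_ge0 (X Y : T -> R) (x y z : R) :
  X \in Lfun P 2%:E -> Y \in Lfun P 2%:E ->
  {ae P, forall w, (0 <= X w)%R} -> {ae P, forall w, (0 <= Y w)%R} ->
  \int[P]_w `|X w|%:E = x%:E -> \int[P]_w `|Y w|%:E = y%:E ->
  \int[P]_w `|X w * Y w|%:E = z%:E ->
  covariance P X Y = (z - x * y)%:E.
Proof.
move=> X2 Y2 X0 Y0 Ex Ey Ez.
have PT : P setT \is a fin_num by rewrite probability_setT.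
have mX : measurable_fun setT X by exact: (set_mem (sub_Lfun_mfun X2)).
have mY : measurable_fun setT Y by exact: (set_mem (sub_Lfun_mfun Y2)).
have XY1 : (X * Y)%R \in Lfun P 1 := Lfun2_mul_Lfun1 X2 Y2.
rewrite (covarianceE (Lfun_subset12 PT X2) (Lfun_subset12 PT Y2) XY1).
rewrite !expectation_ae_ge0// ?Ex ?Ey ?Ez ?EFinB ?EFinM//.
- exact: measurable_funM.
- by move: X0 Y0; apply: filterS2 => w ? ?; rewrite mulr_ge0.
Qed.

End covariance_of_moments.

(** The arithmetic of the covariance: x, y', y are the means of G_s^beta,
G_t^beta, G_(t-s)^beta, and z that of Q_s Q_t. *)
Lemma centered_bounds {R : realFieldType} (a k x y y' r r' cross z : R) : 0 <= x ->
  y <= y' <= y + r -> cross <= x * y + r' ->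
  k + a ^+ 2 * (x * y) <= z <= k + a ^+ 2 * cross ->
  k - a ^+ 2 * (x * r) <= z - a * x * (a * y') <= k + a ^+ 2 * r'.
Proof.
move=> x0 /andP[y1 y2] cr /andP[z1 z2]; have a20 := sqr_ge0 a.
have e1 := ler_wpM2l a20 cr.
have e2 := ler_wpM2l a20 (ler_wpM2l x0 y1).
have e3 := ler_wpM2l a20 (ler_wpM2l x0 y2).
have -> : a * x * (a * y') = a ^+ 2 * (x * y') by ring.
rewrite !mulrDr in e1 e3.
by apply/andP; split; lra.
Qed.

(** The covariance tends to a nonzero constant, so the decay is that of the
inverse of the standard deviation, which is equivalent to sqrt V t^beta. *)
Lemma correlation_decay {R : realType} (beta k w V : R) (cov var : R -> R) :
  0 < k -> 0 < w -> 0 < V -> (forall t, 0 < t -> 0 < var t) ->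
  cov t @[t --> +oo] --> k -> var t / (t `^ beta) ^+ 2 @[t --> +oo] --> V ->
  exists2 c : R, 0 < c &
    cov t / (Num.sqrt w * Num.sqrt (var t)) / (c * t `^ (- beta)) @[t --> +oo] -->
      (1 : R).
Proof.
move=> k0 w0 V0 var_gt0 cov_cvg var_cvg.
have sw : 0 < Num.sqrt w by rewrite sqrtr_gt0.
have sV : 0 < Num.sqrt V by rewrite sqrtr_gt0.
pose c := k / (Num.sqrt w * Num.sqrt V).
have c0 : 0 < c by rewrite divr_gt0// mulr_gt0.
exists c => //.
apply: (cvgy_eq (r := 0) (f := fun t => cov t / (Num.sqrt w * c) *
    (Num.sqrt (var t / (t `^ beta) ^+ 2))^-1)).
  move=> t t0; have tb : 0 < t `^ beta by exact: powR_gt0.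
  have sv : 0 < Num.sqrt (var t) by rewrite sqrtr_gt0 var_gt0.
  rewrite sqrtrM ?(ltW (var_gt0 _ t0))// -exprVn sqrtr_sqr.
  rewrite ger0_norm ?invr_ge0 ?(ltW tb)// powRN; field.
  by rewrite !gt_eqF.
rewrite -[X in _ --> X](_ : k / (Num.sqrt w * c) * (Num.sqrt V)^-1 = _); last first.
  by rewrite /c; field; rewrite !gt_eqF.
apply: cvgM; first by apply: cvgM; [exact: cov_cvg|exact: cvg_cst].
apply: cvgV; first by rewrite gt_eqF.
by apply: (cvg_comp _ _ var_cvg); exact: sqrt_continuous.
Qed.

(** * Long-range dependence of a subordinated process *)

Section subordinated_power_process.
Context {d : measure_display} {T : measurableType d} {R : realType}.
Variables (P : probability T R) (X : R -> T -> R) (G : R -> {RV P >-> R}).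
Variables (beta a b c m v : R).
Hypothesis beta01 : 0 < beta < 1.
Hypothesis mX : forall t, 0 <= t -> measurable_fun setT (X t).
Hypothesis rcX : forall w t, 0 <= t -> X u w @[u --> t^'+] --> X t w.
Hypothesis subG : subordinator G.
Hypothesis XG : independent_processes P X (fun t => G t).
Hypothesis a0 : 0 < a.
Hypothesis b0 : 0 <= b.
Hypothesis ac : a ^+ 2 < 2 * c.
Hypothesis X_ge0 : forall t, 0 <= t -> {ae P, forall w, 0 <= X t w}.
Hypothesis XE : forall t, 0 <= t ->
  (\int[P]_w `|X t w|%:E = (a * t `^ beta)%:E)%E.
Hypothesis XXE : forall t, 0 <= t ->
  (\int[P]_w `|X t w * X t w|%:E =
    (b * t `^ beta + 2 * c * (t `^ beta) ^+ 2)%:E)%E.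
Hypothesis XX_bounds : forall u v, 0 <= u -> u <= v ->
  ((b * u `^ beta + c * (u `^ beta) ^+ 2 +
     a ^+ 2 * (u `^ beta * (v - u) `^ beta))%:E
    <= \int[P]_w `|X u w * X v w|%:E
    <= (b * u `^ beta + c * (u `^ beta) ^+ 2 +
     a ^+ 2 * (u `^ beta * v `^ beta))%:E)%E.
Hypothesis m0 : 0 < m.
Hypothesis v0 : 0 <= v.
Hypothesis meanG : forall t, 0 <= t -> has_mean P (G t) (m * t).
Hypothesis sqrG : forall t, 0 <= t ->
  has_mean P (fun w => G t w ^+ 2) (v * t + m ^+ 2 * t ^+ 2).

Let mG t : 0 <= t -> measurable_fun setT (G t). Proof. by []. Qed.

Let G0 w t : 0 <= t -> 0 <= G t w. Proof. exact: subordinator_ge0. Qed.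

Let c0 : 0 <= c.
Proof. have := sqr_ge0 a; have := ac; lra. Qed.

Let mu := power_mean beta G.
Let nu := power_sqr_mean beta G.
Let Q t w := X (G t w) w.

Let hmu t : 0 <= t -> has_mean P (fun w => G t w `^ beta) (mu t).
Proof. exact: (has_power_mean beta01 subG meanG). Qed.

Let hnu t : 0 <= t -> has_mean P (fun w => (G t w `^ beta) ^+ 2) (nu t).
Proof. exact: (has_power_sqr_mean beta01 subG sqrG). Qed.

Let Q_ge0 t : 0 <= t -> {ae P, forall w, 0 <= Q t w}.
Proof. exact: (subordinated_ae_ge0 mX rcX mG G0 XG X_ge0). Qed.

Let QE t : 0 <= t -> (\int[P]_w `|Q t w|%:E = (a * mu t)%:E)%E.
Proof.
move=> t0; rewrite (integral_norm_subordinated mX rcX mG G0 XG t0).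
under eq_integral do rewrite XE ?G0//.
by have [_ _] := has_meanZ (ltW a0) (hmu t0).
Qed.

Let QQE t : 0 <= t ->
  (\int[P]_w `|Q t w * Q t w|%:E = (b * mu t + 2 * c * nu t)%:E)%E.
Proof.
move=> t0; have [_ ->] := integral_mul_subordinated mX rcX mG G0 XG t0 t0.
under eq_integral do rewrite XXE ?G0//.
have c20 : 0 <= 2 * c by rewrite mulr_ge0.
by have [_ _] := has_meanD (has_meanZ b0 (hmu t0)) (has_meanZ c20 (hnu t0)).
Qed.

Let cross s t := fine (\int[P]_w (G s w `^ beta * G t w `^ beta)%:E)%E.

Let mpow t : measurable_fun setT (fun w => G t w `^ beta).
Proof. exact: measurableT_comp (measurable_powR _) _. Qed.

Let hcross s t : 0 <= s -> s <= t ->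
  has_mean P (fun w => G s w `^ beta * G t w `^ beta) (cross s t).
Proof.
move=> s0 st; have t0 := le_trans s0 st.
apply: (has_mean_dominated (g := fun w => (G t w `^ beta) ^+ 2)).
- exact: measurable_funM.
- by move=> w; rewrite mulr_ge0 ?powR_ge0.
- exact: hnu.
- move=> w; rewrite expr2 ler_wpM2r ?powR_ge0//.
  apply: ge0_ler_powR; rewrite ?nnegrE ?G0//; first by have /andP[/ltW] := beta01.
  exact: (subordinator_nd subG).
Qed.

(** The two bounds on E[X_u X_v] are averaged at u = G_s and v = G_t. In the lower
one G_t - G_s appears, so that the average factorizes by independence. *)
Let QQ_bounds s t : 0 <= s -> s <= t ->
  exists2 z, (\int[P]_w `|Q s w * Q t w|%:E = z%:E)%E &
    b * mu s + c * nu s + a ^+ 2 * (mu s * mu (t - s)) <= z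
      <= b * mu s + c * nu s + a ^+ 2 * cross s t.
Proof.
move=> s0 st; have t0 := le_trans s0 st.
have ts0 : 0 <= t - s by rewrite subr_ge0.
have a20 : 0 <= a ^+ 2 by exact: sqr_ge0.
have [mI IE] := integral_mul_subordinated mX rcX mG G0 XG s0 t0.
have base := has_meanD (has_meanZ b0 (hmu s0)) (has_meanZ c0 (hnu s0)).
have mp : measurable_fun setT (fun x : R => x `^ beta) by exact: measurable_powR.
have hinc := has_mean_increment subG s0 st mp mp (fun x => powR_ge0 x beta)
  (fun x => powR_ge0 x beta) (hmu s0) (hmu ts0).
have [ml l0 lE] := has_meanD base (has_meanZ a20 hinc).
have [mu_ u0 uE] := has_meanD base (has_meanZ a20 (hcross s0 st)).
have GG w : G s w <= G t w by exact: (subordinator_nd subG).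
have lo : ((b * mu s + c * nu s + a ^+ 2 * (mu s * mu (t - s)))%:E <=
    \int[P]_w `|Q s w * Q t w|%:E)%E.
  rewrite IE -lE; apply: ge0_le_integral => //.
  - by move=> w _; rewrite lee_fin.
  - exact/measurable_EFinP.
  - by move=> w _; have /andP[] := XX_bounds (G0 w s0) (GG w).
have hi : (\int[P]_w `|Q s w * Q t w|%:E <=
    (b * mu s + c * nu s + a ^+ 2 * cross s t)%:E)%E.
  rewrite IE -uE; apply: ge0_le_integral => //.
  - by move=> w _; apply: integral_ge0 => y _; rewrite lee_fin.
  - exact/measurable_EFinP.
  - by move=> w _; have /andP[] := XX_bounds (G0 w s0) (GG w).
have fin : (\int[P]_w `|Q s w * Q t w|%:E)%E \is a fin_num.
  rewrite ge0_fin_numE; first by rewrite (le_lt_trans hi)// ltry.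
  by apply: integral_ge0 => y _; rewrite lee_fin.
exists (fine (\int[P]_w `|Q s w * Q t w|%:E)%E); first by rewrite fineK.
by rewrite -!lee_fin fineK// lo hi.
Qed.

Let Q_L2 t : 0 <= t -> Q t \in Lfun P 2%:E.
Proof.
move=> t0; apply: Lfun2_of_sqr; last by rewrite QQE// ltry.
exact: measurable_subordinated mX rcX mG G0 _ _.
Qed.

Let var t := b * mu t + 2 * c * nu t - a ^+ 2 * mu t ^+ 2.

Let varE t : 0 <= t -> ('V_P[Q t] = (var t)%:E)%E.
Proof.
move=> t0; rewrite /variance (covariance_ae_ge0 (Q_L2 t0) (Q_L2 t0)
  (Q_ge0 t0) (Q_ge0 t0) (QE t0) (QE t0) (QQE t0)).
by congr EFin; rewrite /var; ring.
Qed.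

Let mu_gt0 t : 0 < t -> 0 < mu t.
Proof. exact: (power_mean_gt0 beta01 m0 subG meanG). Qed.

Let mu_nu t : 0 <= t -> mu t ^+ 2 <= nu t.
Proof. exact: (power_mean_sqr_le beta01 subG meanG sqrG). Qed.

Let var_gt0 t : 0 < t -> 0 < var t.
Proof.
move=> t0; have mt := mu_gt0 t0; have h := mu_nu (ltW t0).
have mt2 : 0 < mu t ^+ 2 by exact: exprn_gt0.
have n0 : 0 < nu t by exact: lt_le_trans h.
have e1 : a ^+ 2 * mu t ^+ 2 <= a ^+ 2 * nu t by rewrite ler_wpM2l ?sqr_ge0.
have e2 : a ^+ 2 * nu t < 2 * c * nu t by rewrite ltr_pM2r.
have e3 : 0 <= b * mu t by rewrite mulr_ge0// ltW.
by rewrite /var; lra.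
Qed.

(** The limit of the covariance of Q_s and Q_t. *)
Let kappa s := b * mu s + c * nu s.

Let kappa_gt0 s : 0 < s -> 0 < kappa s.
Proof.
move=> s0; have ms := mu_gt0 s0; have h := mu_nu (ltW s0).
have ms2 : 0 < mu s ^+ 2 by exact: exprn_gt0.
have n0 : 0 < nu s by exact: lt_le_trans h.
have cp : 0 < c by have := sqr_ge0 a; have := ac; lra.
by rewrite /kappa ltr_wpDl ?mulr_gt0// mulr_ge0// ltW.
Qed.

(** [cross_power_bounds] is used twice, to compare mu t with mu (t - s), and
cross s t with mu s * mu (t - s). *)
Let cov_cvg s : 0 < s ->
  fine (covariance P (Q s) (Q t)) @[t --> +oo] --> kappa s.
Proof.
move=> s0; have s0' := ltW s0.
pose rho A B t := A * (v * (t - s) / (m * (t - s) / 2) ^+ 2) +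
  B * ((m * (t - s) / 2) `^ beta / (m * (t - s) / 2)).
have mp : measurable_fun setT (fun x : R => x `^ beta) by exact: measurable_powR.
pose B1 := fine (\int[P]_w (G s w `^ beta * G s w)%:E)%E.
have hB1 : has_mean P (fun w => G s w `^ beta * G s w) B1.
  apply: (has_mean_dominated _ _ (has_meanD (hnu s0') (sqrG s0'))).
  - exact: measurable_funM.
  - by move=> w; rewrite mulr_ge0 ?powR_ge0 ?G0.
  - move=> w /=; have := powR_ge0 (G s w) beta; have := G0 w s0'.
    by have := sqr_ge0 (G s w `^ beta - G s w); nra.
have bounds t : s < t ->
    kappa s - a ^+ 2 * (mu s * rho (mu s) (m * s) t) <=
      fine (covariance P (Q s) (Q t)) <= kappa s + a ^+ 2 * rho (nu s) B1 t.
  move=> st; have t0 : 0 <= t by rewrite (le_trans s0')// ltW.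
  have [z zE /andP[lo hi]] := QQ_bounds s0' (ltW st).
  rewrite (covariance_ae_ge0 (Q_L2 s0') (Q_L2 t0) (Q_ge0 s0') (Q_ge0 t0)
    (QE s0') (QE t0) zE)/=.
  have one : has_mean P (fun w => 1 * G s w `^ beta) (mu s).
    by apply: has_mean_eq (hmu s0') => w; rewrite mul1r.
  have one' : has_mean P (fun w => 1 * G s w) (m * s).
    by apply: has_mean_eq (meanG s0') => w; rewrite mul1r.
  have one'' : has_mean P (fun w => 1 * G t w `^ beta) (mu t).
    by apply: has_mean_eq (hmu t0) => w; rewrite mul1r.
  have m1 : measurable_fun setT (fun _ : R => 1 : R) by exact: measurable_cst.
  have mu_near : 1 * mu (t - s) <= mu t <= 1 * mu (t - s) + rho (mu s) (m * s) t.
    exact: (cross_power_bounds beta01 m0 subG meanG sqrG s0' st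
      m1 (fun=> ler01) (has_mean_cst P ler01) one one' one'').
  rewrite mul1r in mu_near.
  have sq : has_mean P (fun w => G s w `^ beta * G s w `^ beta) (nu s).
    by apply: has_mean_eq (hnu s0') => w; rewrite expr2.
  have /andP[lo1 hi1] := cross_power_bounds beta01 m0 subG meanG sqrG s0' st
    mp (fun x => powR_ge0 x beta) (hmu s0') sq hB1 (hcross s0' (ltW st)).
  apply: (centered_bounds (ltW (mu_gt0 s0)) mu_near hi1).
  by apply/andP; split; [exact: lo|exact: hi].
have rho0 A B : rho A B t @[t --> +oo] --> 0 by exact: remainder_cvgy0.
have lim_lo : kappa s - a ^+ 2 * (mu s * rho (mu s) (m * s) t) @[t --> +oo] --> kappa s.
  rewrite -[X in _ --> X](_ : kappa s - a ^+ 2 * (mu s * 0) = _); last first.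
    by rewrite !mulr0 subr0.
  apply: cvgB; first exact: cvg_cst.
  by apply: cvgM; [exact: cvg_cst|apply: cvgM; [exact: cvg_cst|exact: rho0]].
have lim_hi : kappa s + a ^+ 2 * rho (nu s) B1 t @[t --> +oo] --> kappa s.
  rewrite -[X in _ --> X](_ : kappa s + a ^+ 2 * 0 = _); last by rewrite mulr0 addr0.
  apply: cvgD; first exact: cvg_cst.
  by apply: cvgM; [exact: cvg_cst|exact: rho0].
apply: squeeze_cvgr lim_lo lim_hi.
near=> t; apply: bounds.
by near: t; apply: nbhs_pinfty_gt; rewrite num_real.
Unshelve. all: by end_near. Qed.

Let mb0 : 0 < m `^ beta. Proof. exact: powR_gt0. Qed.

Let normalized_cvg (g : R -> R) (K l : R) :
  (forall t, 1 <= t -> `|g t - 1| <= K / Num.sqrt t) ->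
  l * g t @[t --> +oo] --> l.
Proof.
move=> gK; rewrite -[X in _ --> X]mulr1; apply: cvgM; first exact: cvg_cst.
have lim0 : K / Num.sqrt t @[t --> +oo] --> 0.
  rewrite -[X in _ --> X](mulr0 K); apply: cvgM; first exact: cvg_cst.
  exact: sqrt_inv_cvgy0.
have lim_lo : 1 - K / Num.sqrt t @[t --> +oo] --> (1 : R).
  by rewrite -[X in _ --> X]subr0; apply: cvgB => //; exact: cvg_cst.
have lim_hi : 1 + K / Num.sqrt t @[t --> +oo] --> (1 : R).
  by rewrite -[X in _ --> X]addr0; apply: cvgD => //; exact: cvg_cst.
apply: squeeze_cvgr lim_lo lim_hi; near=> t.
have t1 : 1 <= t by near: t; apply: nbhs_pinfty_ge; rewrite num_real.
by have := gK t t1; rewrite ler_norml => /andP[]; lra.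
Unshelve. all: by end_near. Qed.

Let mu_cvg : mu t / t `^ beta @[t --> +oo] --> m `^ beta.
Proof.
apply: (cvgy_eq (r := 0) (f := fun t => m `^ beta * (mu t / (m * t) `^ beta))).
  move=> t t0; rewrite powRM ?(ltW m0) ?(ltW t0)//; field.
  by rewrite !gt_eqF ?powR_gt0.
apply: (normalized_cvg (K := 1 + v / m ^+ 2)) => t t1.
by have [] := normalized_power_means beta01 m0 v0 subG meanG sqrG t1.
Qed.

Let nu_cvg : nu t / (t `^ beta) ^+ 2 @[t --> +oo] --> (m `^ beta) ^+ 2.
Proof.
apply: (cvgy_eq (r := 0)
    (f := fun t => (m `^ beta) ^+ 2 * (nu t / ((m * t) `^ beta) ^+ 2))).
  move=> t t0; rewrite powRM ?(ltW m0) ?(ltW t0)//; field.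
  by rewrite !gt_eqF ?powR_gt0.
apply: (normalized_cvg (K := 2 * (1 + v / m ^+ 2))) => t t1.
by have [] := normalized_power_means beta01 m0 v0 subG meanG sqrG t1.
Qed.

(** The limit of the variance divided by t^(2 beta). *)
Let vinf := (2 * c - a ^+ 2) * (m `^ beta) ^+ 2.

Let vinf_gt0 : 0 < vinf.
Proof. by rewrite mulr_gt0 ?exprn_gt0// subr_gt0. Qed.

Let var_cvg : var t / (t `^ beta) ^+ 2 @[t --> +oo] --> vinf.
Proof.
pose M t := mu t / t `^ beta.
apply: (cvgy_eq (r := 0) (f := fun t => b * (M t * (t `^ beta)^-1) +
    2 * c * (nu t / (t `^ beta) ^+ 2) - a ^+ 2 * (M t * M t))).
  by move=> t t0; rewrite /M /var; field; rewrite gt_eqF ?powR_gt0.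
rewrite -[X in _ --> X](_ : b * (m `^ beta * 0) + 2 * c * (m `^ beta) ^+ 2 -
  a ^+ 2 * (m `^ beta * m `^ beta) = _); last by rewrite /vinf; ring.
have bp : 0 < beta by have /andP[] := beta01.
apply: cvgB; [apply: cvgD|].
- by apply: cvgM; [exact: cvg_cst|apply: cvgM; [exact: mu_cvg|exact: powR_inv_cvgy0]].
- by apply: cvgM; [exact: cvg_cst|exact: nu_cvg].
- by apply: cvgM; [exact: cvg_cst|apply: cvgM; exact: mu_cvg].
Qed.

(** This holds for any process whose two-time moments have the form found in
[fpp_second_order], time-changed by any independent subordinator with a positive
mean and a finite variance: the stable and gamma laws have done their part. *)
Lemma long_range_dependent_subordinated :
  long_range_dependent P (fun t w => X (G t w) w).
Proof.
split; first exact: Q_L2.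
exists beta => // s s0.
have [k k0 lim] := correlation_decay (kappa_gt0 s0) (var_gt0 s0) vinf_gt0 var_gt0
  (cov_cvg s0) var_cvg.
exists k => //; apply: (cvgy_eq (r := 0)) lim => t t0.
by rewrite /correlation (varE (ltW s0)) (varE (ltW t0)).
Qed.

End subordinated_power_process.

Theorem theorem4p4 (d : measure_display) (T : measurableType d) (R : realType)
    (P : probability T R) (beta alpha p lambda : R)
    (beta01 : 0 < beta < 1) (alpha0 : 0 < alpha) (p0 : 0 < p)
    (lambda0 : 0 < lambda)
    (D N G : R -> {RV P >-> R})
    (D_stable : stable_subordinator beta D)
    (N_poisson : poisson_process lambda N)
    (G_gamma : gamma_process alpha p G)
    (N_indep : independent_processes P (fun t => N t) (inverse_process D))
    (Nbeta_indep : independent_processes P (fpp D N) (fun t => G t)) :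
  long_range_dependent P (fnbp D N G).
Proof.
have [a [b [c [a0 b0 ac X_ge0 [XE XXE XX_bounds]]]]] :=
  fpp_second_order beta01 lambda0 D_stable N_poisson N_indep.
have [m [v [m0 v0 meanG sqrG]]] := gamma_second_order alpha0 p0 G_gamma.
apply: (long_range_dependent_subordinated beta01 (measurable_fpp D_stable N_poisson)
  _ (gamma_sub G_gamma) Nbeta_indep a0 b0 ac X_ge0 XE XXE XX_bounds m0 v0 meanG sqrG).
by move=> w t; exact: fpp_right_continuous (poisson_levy N_poisson) w t.
Qed.
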